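(* Let $\mathcal{D}=(V,E,F)$ be the cellular decomposition of $\mathbb{R}^2$ by the square lattice: $V=\mathbb{Z}^2$, with $E$ consisting of the pairs of lattice points at Euclidean distance $1$. In Euclidean background geometry, let $\Theta_e=\frac{\pi}{2}$ for all $e\in E$. Then there exists a universal constant $\epsilon>0$ such that for any initial data $r(0)\in(0,\infty)^V$ satisfying $\|\ln r(0)\|_{l^2}\le\epsilon$, the solution $r(t)$ to the combinatorial Ricci flow $$\frac{\mathrm{d}r_i}{\mathrm{d}t}=-K_i\,r_i,\qquad\forall v_i\in V,\ t\ge0,$$ with initial value $r(0)$ converges to the regular circle packing metric $r_{\mathrm{reg}}\equiv1$. Moreover, the logarithmic variable $u(t)=\ln r(t)$ satisfies $u\in C^1([0,\infty),l^2(V))$, $$\|u(t)\|_{l^\infty}\to0\quad\text{as }t\to\infty,$$ and $$\mathcal{E}(u(t)):=\sum_{[i,j]\in E}|u(i,t)-u(j,t)|^2\le C(1+t)^{-1}\quad\text{for all }t\ge0,$$ where $C=C(\epsilon)$ depends only on $\epsilon$.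
   Context: $F$ is the set of unit squares of the lattice; $j\sim i$ means $v_i,v_j$ are joined by an edge; $u(i,t)=u_i(t)$; each undirected edge is counted once in $\mathcal{E}$. $l^p(V)$ is the $l^p$ space with respect to counting measure. A circle packing metric is a function $r:V\to(0,\infty)$, $r_i=r(v_i)$. For an edge $[v_i,v_j]$ with intersection angle $\Theta_{ij}$, consider the Euclidean triangle $v_iv_jv_f$ with $|v_iv_f|=r_i$, $|v_jv_f|=r_j$, $|v_iv_j|=\sqrt{r_i^2+r_j^2+2r_ir_j\cos\Theta_{ij}}$; let $\theta_{ij}$ be its inner angle at $v_i$. The discrete Gaussian curvature is $K_i(r)=2\pi-2\sum_{j\sim i}\theta_{ij}(r_i,r_j)$. For $\Theta\equiv\pi/2$ this gives $\theta_{ij}=\arctan(r_j/r_i)$. *)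

(* Defs.v *)
From HB Require Import structures.
From mathcomp Require Import all_boot all_order all_algebra.
From mathcomp Require Import all_classical all_reals all_analysis.
Set Implicit Arguments.
Unset Strict Implicit.
Unset Printing Implicit Defensive.
Import Order.TTheory GRing.Theory Num.Theory.
Import numFieldNormedType.Exports.
Local Open Scope classical_set_scope.
Local Open Scope ring_scope.

(* An alias of int * int, so that it can carry the discrete sigma-algebra. *)
Definition lattice : Type := (int * int)%type.

HB.instance Definition _ := Choice.copy lattice (int * int)%type.
HB.instance Definition _ := isPointed.Build lattice (0, 0).
HB.instance Definition _ := @isMeasurable.Build default_measure_display
  lattice discrete_measurable discrete_measurable0
  discrete_measurableC discrete_measurableU.

(* Euclidean distance 1, i.e. squared distance 1. *)
Definition adjacent (i j : lattice) : Prop :=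
  (i.1 - j.1) ^+ 2 + (i.2 - j.2) ^+ 2 = 1.

(* Each undirected edge occurs once, oriented in the direction of increasing
   coordinates: the endpoints of an edge differ in exactly one coordinate. *)
Definition edges : set (lattice * lattice) :=
  [set e | [/\ adjacent e.1 e.2, e.1.1 <= e.2.1 & e.1.2 <= e.2.2]].

Section CirclePacking.
Context {R : realType}.
Implicit Types (r u : lattice -> R) (Theta : lattice -> lattice -> R).

(* The length of the side v_i v_j when |v_i v_f| = a, |v_j v_f| = b. *)
Definition side_length (T a b : R) : R :=
  Num.sqrt (a ^+ 2 + b ^+ 2 + 2 * a * b * cos T).

(* The angle between the sides of lengths a and c in the Euclidean triangle
   with side lengths a, b, c (law of cosines). *)
Definition inner_angle (a b c : R) : R :=
  acos ((a ^+ 2 + c ^+ 2 - b ^+ 2) / (2 * a * c)).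

Definition theta (T ri rj : R) : R :=
  inner_angle ri rj (side_length T ri rj).

Definition curvature Theta r (i : lattice) : R :=
  2 * pi - 2 * \sum_(j \in [set j | adjacent j i]) theta (Theta i j) (r i) (r j).

(* Difference quotients at t are taken within [0, +oo[, so that at t = 0 this
   is the right derivative and at t > 0 the ordinary one. *)
Definition has_deriv_ge0 (f : R -> R) (t d : R) : Prop :=
  (s - t)^-1 * (f s - f t) @[s --> within [set s | 0 <= s] t^'] --> d.

(* Only the values of r at times t >= 0 are relevant. *)
Definition ricci_flow Theta (r0 : lattice -> R) (r : R -> lattice -> R) : Prop :=
  r 0 = r0 /\
  forall t : R, 0 <= t -> forall i,
    0 < r t i /\
    has_deriv_ge0 (fun s => r s i) t (- curvature Theta (r t) i * r t i).

(* The l^p norm, with value +oo outside of l^p(V). *)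
Definition lnorm (p : \bar R) u : \bar R := ('N[counting]_p[EFin \o u])%E.

(* u restricted to [0, +oo[ is C^1 as a map into l^2(V), with derivative v. *)
Definition C1_l2 (u : R -> lattice -> R) : Prop :=
  exists v : R -> lattice -> R, forall t : R, 0 <= t ->
    [/\ (lnorm 2%:E (u t) < +oo)%E,
        (lnorm 2%:E (v t) < +oo)%E,
        lnorm 2%:E (fun i => (s - t)^-1 * (u s i - u t i) - v t i)
          @[s --> within [set s | 0 <= s] t^'] --> 0%E
      & lnorm 2%:E (fun i => v s i - v t i)
          @[s --> within [set s | 0 <= s] (nbhs t)] --> 0%E].

Definition energy u : \bar R :=
  (\esum_(e in edges) (`|u e.1 - u e.2| ^+ 2)%:E)%E.

End CirclePacking.

(* Main.v *)
Require Import Defs.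
From mathcomp Require Import all_boot all_order all_algebra.
From mathcomp Require Import all_classical all_reals all_analysis.
From mathcomp Require Import ess_sup_inf.
From mathcomp Require Import ring lra zify.
Import Order.TTheory GRing.Theory Num.Theory.
Import numFieldNormedType.Exports.
Set Implicit Arguments.
Unset Strict Implicit.
Unset Printing Implicit Defensive.
Local Open Scope classical_set_scope.
Local Open Scope ring_scope.

(** For right angles 2 theta(a, b) - pi / 2 = gd (ln b - ln a), where
    gd x = 2 atan (exp x) - pi / 2 is the Gudermannian function, which is odd,
    nondecreasing, bounded and 1-Lipschitz. So the logarithms u = ln r of the
    radii obey u_i' = sum over the neighbours j of i of gd (u_j - u_i); the right
    hand side is called the velocity of u.

    Existence and uniqueness. The velocity is bounded by 8 and 8-Lipschitz both
    in the sup norm and in l^2. Picard iteration therefore converges on the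
    whole half line and stays in l^2 (exists_solution). Because the velocity is
    bounded, two arbitrary solutions with the same initial value differ by a
    bounded amount on bounded time intervals, and this difference can be halved
    again and again (solution_unique).

    Decay. Let G be the even primitive of gd and let Phi(u) be the sum of
    G (u_i - u_j) over the edges. The flow is the gradient descent of the convex
    function Phi: summation by parts (velocity_by_parts) gives
    <w, velocity u> = - sum over edges of (dw) gd (du), and convexity gives
    Phi(u) <= - <u, velocity u>. Hence |u|^2 + 2 t Phi(u), with the l^2 norm,
    does not increase along the flow (lyapunov): its derivative is
    2 <u, velocity u> + 2 Phi(u) - 2 t |velocity u|^2 <= 0. This single
    monotone quantity yields |u(t)|_2 <= |u(0)|_2 and
    2 t Phi(u(t)) <= |u(0)|_2^2. When |u(0)|_2 <= 1/4 all differences along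
    edges are at most 1/2, where G(x) >= x^2 / 4, so that the Dirichlet energy is
    at most 4 Phi and decays like 1 / (1 + t).

    Sup norm. Telescoping u^2 along a half line of the lattice, on which u is
    square summable, bounds u_i^2 by E / (2 l) + 2 l |u|_2^2 for every l > 0, where
    E is the energy (sup_bound); as E tends to 0, so does the sup norm.

    Differentiating sums over the infinite lattice is avoided throughout. The
    mean value inequality in l^2 (mvt_l2) is obtained from scalar functions by
    testing against a finitely supported vector, and monotonicity of the Lyapunov
    function from the increment estimate q(t) - q(s) <= K (t - s)^2 (descent). *)

(** * Sums over the lattice *)

Section Sums.
Context {R : realType}.
Implicit Types (f g : lattice -> R).

Definition summ f := (@counting lattice R).-integrable setT (EFin \o f).
Definition total f : R := \int[@counting lattice R]_i f i.

Lemma measurable_lattice (A : set lattice) : measurable A.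
Proof. by []. Qed.

Lemma measurable_fun_lattice d (T : measurableType d) (D : set lattice)
  (f : lattice -> T) : measurable_fun D f.
Proof. by []. Qed.
Hint Resolve measurable_lattice measurable_fun_lattice : core.

Lemma summD f g : summ f -> summ g -> summ (fun i => f i + g i).
Proof. by move=> sf sg; exact: (integrableD measurableT sf sg). Qed.

Lemma summZ (c : R) f : summ f -> summ (fun i => c * f i).
Proof. by move=> sf; exact: (integrableZl measurableT c sf). Qed.

Lemma summN f : summ f -> summ (fun i => - f i).
Proof. by move=> sf; exact: (integrableN sf). Qed.

Lemma summ_le f g : (forall i, `|f i| <= g i) -> summ g -> summ f.
Proof.
move=> fg; apply: le_integrable => // i _ /=.
by rewrite lee_fin (le_trans (fg i))// ler_norm.
Qed.

Lemma totalD f g : summ f -> summ g ->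
  total (fun i => f i + g i) = total f + total g.
Proof. by move=> sf sg; rewrite /total RintegralD. Qed.

Lemma totalZ (c : R) f : summ f -> total (fun i => c * f i) = c * total f.
Proof. by move=> sf; rewrite /total RintegralZl. Qed.

Lemma totalN f : summ f -> total (fun i => - f i) = - total f.
Proof.
move=> sf; rewrite -mulN1r -totalZ//; congr total; apply/funext => i.
by rewrite mulN1r.
Qed.

Lemma total_le f g : summ f -> summ g -> (forall i, f i <= g i) ->
  total f <= total g.
Proof. by move=> sf sg fg; apply: le_Rintegral. Qed.

Lemma total_ge0 f : (forall i, 0 <= f i) -> 0 <= total f.
Proof. by move=> f0; apply: Rintegral_ge0. Qed.

Lemma integral_lattice1 (f : lattice -> \bar R) x : (0 <= f x)%E ->
  (\int[@counting lattice R]_(i in [set x]) f i = f x)%E.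
Proof.
move=> fx0; have -> : (\int[@counting lattice R]_(i in [set x]) f i =
   \int[@counting lattice R]_(i in [set x]) cst (f x) i)%E.
  by apply: eq_integral => i; rewrite inE/= => ->.
rewrite integral_cst//.
suff E1 : @counting lattice R [set x] = 1%E.
  by transitivity (f x * 1)%E; [congr (_ * _)%E|rewrite mule1].
rewrite /counting; case: asboolP => [_|]; last by case; exact: finite_set1.
by rewrite fset_set1 finmap.cardfs1.
Qed.

Lemma integral_lattice_seq (f : lattice -> \bar R) (s : seq lattice) :
  (forall i, 0 <= f i)%E -> uniq s ->
  (\int[@counting lattice R]_(i in [set` s]) f i = \sum_(i <- s) f i)%E.
Proof.
move=> f0 us; have -> : [set` s] = \big[setU/set0]_(i <- s) [set i].
  rewrite -bigcup_seq; apply/seteqP; split => [i is_|i [j js ->//]].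
  by exists i.
rewrite ge0_integral_bigsetU//.
  by apply: eq_bigr => i _; rewrite integral_lattice1.
by apply/trivIsetP => i j _ _ ij; rewrite -subset0 => k [/= -> /= eij];
  move: ij; rewrite eij eqxx.
Qed.

Lemma integral_lattice_ge (f : lattice -> \bar R) (s : seq lattice) :
  (forall i, 0 <= f i)%E -> uniq s ->
  (\sum_(i <- s) f i <= \int[@counting lattice R]_i f i)%E.
Proof.
move=> f0 us; rewrite -integral_lattice_seq//.
exact: ge0_subset_integral.
Qed.

(** The lattice is countable, so the integral against the counting measure is
    a series whose partial sums are sums over finite duplicate-free lists. *)
Lemma integral_lattice_le (f : lattice -> \bar R) (M : \bar R) :
  (forall i, 0 <= f i)%E ->
  (forall s : seq lattice, uniq s -> \sum_(i <- s) f i <= M)%E ->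
  (\int[@counting lattice R]_i f i <= M)%E.
Proof.
move=> f0 fM.
have -> : [set: lattice] = \bigcup_n
   [set x : lattice | pickle (x : int * int) = n].
  by apply/seteqP; split => // x _; exists (pickle (x : int * int)).
rewrite ge0_integral_bigcup//; last first.
  by apply/trivIsetP => i j _ _ ij; rewrite -subset0 => k [/= -> /= eij];
    move: ij; rewrite eij eqxx.
have E n : exists s : seq lattice, [/\ uniq s, 
   forall x, x \in s -> (pickle (x : int * int) < n)%N &
   (\sum_(0 <= k < n) \int[@counting lattice R]_(i in [set x : lattice |
   pickle (x : int * int) = k]) f i = \sum_(i <- s) f i)%E].
  elim: n => [|n [s [us ls es]]].
    by exists [::]; split => //; rewrite big_geq// big_nil.
  rewrite big_nat_recr//= es.
  case: (pselect (exists x : lattice, pickle (x : int * int) = n)) => [[x xn]|nx].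
    exists (rcons s x); split.
    - rewrite rcons_uniq us andbT; apply/negP => /ls.
      by rewrite xn ltnn.
    - move=> y; rewrite mem_rcons inE => /orP[/eqP ->|/ls/ltnW//].
      by rewrite xn.
    rewrite -cats1 big_cat big_seq1/=; congr (_ + _)%E.
    have -> : [set x : lattice | pickle (x : int * int) = n] = [set x].
      apply/seteqP; split => y /=; last by move=> ->.
      by rewrite -xn => /(pcan_inj pickleK).
    exact: integral_lattice1.
  exists s; split => //; first by move=> x /ls/ltnW.
  have -> : [set x : lattice | pickle (x : int * int) = n] = set0.
    by rewrite -subset0 => y /= yn; apply: nx; exists y.
  by rewrite integral_set0 adde0.
apply: lime_le; first by apply: is_cvg_nneseries => n _ _; exact: integral_ge0.
by apply: nearW => n; have [s [us _ ->]] := E n; exact: fM.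
Qed.

(** Summability of a nonnegative function is always established through its
    finite partial sums; this is what lets finite-dimensional estimates pass to
    the whole lattice without limit theorems. *)
Lemma summ_total_le f (M : R) : (forall i, 0 <= f i) ->
  (forall s : seq lattice, uniq s -> \sum_(i <- s) f i <= M) ->
  summ f /\ total f <= M.
Proof.
move=> f0 fM.
have iM : (\int[@counting lattice R]_i (f i)%:E <= M%:E)%E.
  apply: integral_lattice_le => [i|s us]; first by rewrite lee_fin.
  by rewrite sumEFin lee_fin fM.
have i0 : (0 <= \int[@counting lattice R]_i (f i)%:E)%E.
  by apply: integral_ge0 => i _; rewrite lee_fin.
split; last first.
  rewrite /total /Rintegral -lee_fin fineK// ge0_fin_numE//.
  by rewrite (le_lt_trans iM) ?ltry.
apply/integrableP; split => //.
under eq_integral => i _ do rewrite /= ger0_norm//.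
by rewrite (le_lt_trans iM) ?ltry.
Qed.

Lemma total_ge_seq f (s : seq lattice) : (forall i, 0 <= f i) -> summ f ->
  uniq s -> \sum_(i <- s) f i <= total f.
Proof.
move=> f0 sf us; rewrite -lee_fin /total /Rintegral fineK; last first.
  exact: integrable_fin_num.
by rewrite -sumEFin; apply: integral_lattice_ge => // i; rewrite lee_fin.
Qed.

Lemma total_ge1 f i : (forall i, 0 <= f i) -> summ f -> f i <= total f.
Proof. by move=> f0 sf; have := @total_ge_seq f [:: i] f0 sf isT; rewrite big_seq1. Qed.

Lemma summ_reindex_ge0 h k f : cancel h k -> (forall i, 0 <= f i) -> summ f ->
  summ (f \o h) /\ total (f \o h) <= total f.
Proof.
move=> hk f0 sf; apply: summ_total_le => [i|s us]; first exact: f0.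
have -> : \sum_(i <- s) (f \o h) i = \sum_(i <- map h s) f i by rewrite big_map.
by apply: total_ge_seq => //; rewrite map_inj_uniq//; exact: can_inj hk.
Qed.

Lemma summ_reindex h k f : cancel h k -> summ f -> summ (f \o h).
Proof.
move=> hk sf.
have sn : summ (fun i => `|f i|) by exact: integrable_norm sf.
have [sh _] := summ_reindex_ge0 hk (fun i => normr_ge0 (f i)) sn.
by apply: summ_le sh => i /=.
Qed.

(** Translation invariance of lattice sums, the source of summation by parts.
    Nonnegative functions are compared in both directions through their finite
    sums; a general f is the difference of f + |f| and |f|. *)
Lemma total_reindex h k f : cancel h k -> cancel k h -> summ f ->
  total (f \o h) = total f.
Proof.
move=> hk kh sf.
have ge0 (g : lattice -> R) : (forall i, 0 <= g i) -> summ g ->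
    total (g \o h) = total g.
  move=> g0 sg; have [sh lh] := summ_reindex_ge0 hk g0 sg.
  apply/eqP; rewrite eq_le lh/=.
  have [_] := @summ_reindex_ge0 _ _ (g \o h) kh (fun i => g0 (h i)) sh.
  suff -> : (g \o h) \o k = g by [].
  by apply/funext => i /=; rewrite kh.
have sn : summ (fun i => `|f i|) by exact: integrable_norm sf.
have sp : summ (fun i => f i + `|f i|) by exact: summD.
have p0 i : 0 <= f i + `|f i| by have := ler_norm (- f i); rewrite normrN; lra.
have shf : summ (f \o h) by exact: summ_reindex sf.
have shn : summ ((fun i => `|f i|) \o h) by exact: (summ_reindex hk sn).
have E : total (f \o h) + total ((fun i => `|f i|) \o h) =
    total f + total (fun i => `|f i|).
  rewrite -totalD//; first by rewrite -totalD//; exact: (ge0 _ p0 sp).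
move: E; rewrite (ge0 _ (fun i => normr_ge0 (f i)) sn).
exact: addIr.
Qed.

End Sums.

(** * Mean value inequalities and primitives *)

Section Calculus.
Context {R : realType}.

Lemma derive_ge0_le (f df : R -> R) (a b : R) : a <= b ->
  {within `[a, b], continuous f} ->
  (forall x, a < x < b -> is_derive x 1 f (df x)) ->
  (forall x, a < x < b -> 0 <= df x) -> f a <= f b.
Proof.
rewrite le_eqVlt => /predU1P[->//|ab] cf df_ df0.
have df' x : x \in `]a, b[ -> is_derive x 1 f (df x).
  by rewrite in_itv/=; exact: df_.
have [c + E] := MVT ab df' cf.
rewrite in_itv/= => /df0 dc0; rewrite -subr_ge0 E mulr_ge0// subr_ge0.
exact: ltW.
Qed.

Lemma is_derive_sum_seq (I : Type) (s : seq I) (f : I -> R -> R) (df : I -> R)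
  (x : R) : (forall i, is_derive x 1 (f i) (df i)) ->
  is_derive x 1 (fun y => \sum_(i <- s) f i y) (\sum_(i <- s) df i).
Proof.
move=> H; elim: s => [|i s IH].
  rewrite big_nil; under eq_fun do rewrite big_nil.
  exact: is_derive_cst.
rewrite big_cons; under eq_fun do rewrite big_cons.
exact: is_deriveD.
Qed.

Lemma continuous_sum_seq (T : topologicalType) (I : Type) (s : seq I)
  (f : I -> T -> R) : (forall i, continuous (f i)) ->
  continuous (fun y => \sum_(i <- s) f i y).
Proof.
move=> H; elim: s => [|i s IH] x.
  under eq_fun do rewrite big_nil.
  exact: cvg_cst.
under eq_fun do rewrite big_cons.
by apply: cvgD; [exact: H|exact: IH].
Qed.

(** Duality reduces the vector-valued inequality to a scalar one: with
    w = f b - f a of norm N, the function N p - <w, f> is nondecreasing by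
    Cauchy-Schwarz, and comparing its values at a and b gives
    N^2 <= N (p b - p a). *)
Lemma mvt_l2 (I : Type) (s : seq I) (f df : R -> I -> R) (p dp : R -> R)
  (a b : R) : a <= b ->
  (forall i, {within `[a, b], continuous (f^~ i)}) ->
  {within `[a, b], continuous p} ->
  (forall x i, a < x < b -> is_derive x 1 (f^~ i) (df x i)) ->
  (forall x, a < x < b -> is_derive x 1 p (dp x)) ->
  (forall x, a < x < b -> 0 < dp x) ->
  (forall x, a < x < b -> \sum_(i <- s) df x i ^+ 2 <= dp x ^+ 2) ->
  \sum_(i <- s) (f b i - f a i) ^+ 2 <= (p b - p a) ^+ 2.
Proof.
move=> ab cf cp Df Dp dp0 dfp.
pose w i := f b i - f a i.
set N2 := \sum_(i <- s) _.
have : 0 <= N2 by apply: sumr_ge0 => i _; exact: sqr_ge0.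
rewrite le_eqVlt => /predU1P[<-|N20]; first exact: sqr_ge0.
pose N := Num.sqrt N2.
have N0 : 0 < N by rewrite sqrtr_gt0.
have NE : N ^+ 2 = N2 by rewrite sqr_sqrtr// ltW.
pose h x := N * p x - \sum_(i <- s) w i * f x i.
have : h a <= h b.
  apply: (@derive_ge0_le h (fun x => N * dp x - \sum_(i <- s) w i * df x i)) => //.
  - move=> x; apply: cvgB; first by apply: cvgM; [exact: cvg_cst|exact: cp].
    apply: (@continuous_sum_seq (subspace `[a, b]) _ s (fun i y => w i * f y i)).
    by move=> i y; apply: cvgM; [exact: cvg_cst|exact: cf].
  - move=> x xab; apply: is_deriveB.
      have := is_deriveZ N (Dp _ xab); exact.
    apply: is_derive_sum_seq => i.
    have := is_deriveZ (w i) (Df _ i xab); exact.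
  move=> x xab; rewrite subr_ge0.
  have l0 := dp0 _ xab.
  apply: (@le_trans _ _ (\sum_(i <- s) ((dp x / N / 2) * w i ^+ 2 +
     (N / dp x / 2) * df x i ^+ 2))).
    (* Young's inequality; with the weight dp x / N each of the two
       sums below is at most N * dp x / 2 *)
    apply: ler_sum => i _.
    have -> : w i * df x i = (dp x / N / 2) * w i ^+ 2 +
     (N / dp x / 2) * df x i ^+ 2 -
      (dp x / N / 2) * (w i - N / dp x * df x i) ^+ 2.
      by field; rewrite !gt_eqF.
    rewrite gerBl mulr_ge0 ?sqr_ge0//.
    by rewrite !divr_ge0// ltW.
  rewrite big_split/= -!mulr_sumr.
  have -> : \sum_(i <- s) w i ^+ 2 = N ^+ 2 by rewrite NE.
  have : N / dp x / 2 * \sum_(i <- s) df x i ^+ 2 <= N / dp x / 2 * dp x ^+ 2.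
    by rewrite ler_pM2l ?dfp// !divr_gt0.
  move=> /(lerD (lexx (dp x / N / 2 * N ^+ 2)))/le_trans; apply.
  by rewrite le_eqVlt; apply/orP; left; apply/eqP; field; rewrite !gt_eqF.
rewrite /h -subr_ge0.
have -> : N * p b - \sum_(i <- s) w i * f b i -
  (N * p a - \sum_(i <- s) w i * f a i) = N * (p b - p a) - N ^+ 2.
  rewrite NE /N2 mulrBr; under [in RHS]eq_bigr do rewrite expr2 mulrBr.
  rewrite sumrB /w; ring.
rewrite expr2 -mulrBr pmulr_rge0// subr_ge0 => Np.
by rewrite -NE ler_sqr// nnegrE ?(le_trans _ Np)// ltW.
Qed.

Lemma mvt_abs (f df p dp : R -> R) (a b : R) : a <= b ->
  {within `[a, b], continuous f} ->
  {within `[a, b], continuous p} ->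
  (forall x, a < x < b -> is_derive x 1 f (df x)) ->
  (forall x, a < x < b -> is_derive x 1 p (dp x)) ->
  (forall x, a < x < b -> `|df x| <= dp x) ->
  `|f b - f a| <= p b - p a.
Proof.
move=> ab cf cp Df Dp H; rewrite ler_norml -subr_ge0 opprK -[X in _ && X]subr_ge0.
apply/andP; split.
  have : p a + f a <= p b + f b; last by lra.
  apply: (@derive_ge0_le (p + f) (fun x => dp x + df x)) => //.
  - by move=> x; apply: cvgD; [exact: cp|exact: cf].
  - by move=> x xab; apply: is_deriveD; [exact: Dp|exact: Df].
  - by move=> x /H; rewrite ler_norml => /andP[]; lra.
have : p a - f a <= p b - f b; last by lra.
apply: (@derive_ge0_le (p - f) (fun x => dp x - df x)) => //.
- by move=> x; apply: cvgB; [exact: cp|exact: cf].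
- by move=> x xab; apply: is_deriveB; [exact: Dp|exact: Df].
- by move=> x /H; rewrite ler_norml => /andP[]; lra.
Qed.

(** Integrating from -1 instead of 0 makes the primitive differentiable at 0
    from both sides. *)
Definition antider (f : R -> R) (t : R) : R :=
  \int[lebesgue_measure]_(x in `[-1, t]) f x -
  \int[lebesgue_measure]_(x in `[-1, 0]) f x.

Lemma antider0 f : antider f 0 = 0.
Proof. by rewrite /antider subrr. Qed.

Lemma is_derive_antider (f : R -> R) (t : R) : continuous f -> 0 <= t ->
  is_derive t 1 (antider f) (f t).
Proof.
move=> cf t0.
have [] := @continuous_FTC1 _ f (BLeft (-1)) t (t + 1) _ _ _ (cf t).
- by rewrite ltrDl.
- apply: continuous_compact_integrable; first exact: segment_compact.
  exact: continuous_subspaceT.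
- by rewrite /Order.lt/=; lra.
move=> D; rewrite derive1E => E; rewrite -[f t]subr0; apply: is_deriveB.
exact: (DeriveDef D E).
Qed.

Lemma is_derive_cont (f : R -> R) (t d : R) :
  is_derive t 1 f d -> {for t, continuous f}.
Proof. by move=> [/derivable1_diffP/differentiable_continuous]. Qed.

End Calculus.

(** * The Gudermannian function *)

Section Gudermann.
Context {R : realType}.
Implicit Types (x y : R).

Definition gd (x : R) : R := 2 * atan (expR x) - pi / 2.

Lemma is_derive_gd x :
  is_derive x 1 gd (2 * expR x / (1 + expR x ^+ 2)).
Proof.
rewrite -[X in is_derive _ _ _ X]subr0.
apply: is_deriveB.
rewrite -mulrA.
apply: (is_deriveZ 2).
rewrite mulrC.
exact: is_derive1_comp.
Qed.

Lemma continuous_gd : continuous gd.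
Proof. by move=> x; exact: is_derive_cont (is_derive_gd x). Qed.

Lemma dgd_bounds x : 0 <= 2 * expR x / (1 + expR x ^+ 2) <= 1.
Proof.
have e0 := expR_gt0 x; have h : 0 < 1 + expR x ^+ 2 by nra.
rewrite divr_ge0 ?mulr_ge0 ?(ltW h) ?(ltW e0)//= ler_pdivrMr// mul1r.
by have := sqr_ge0 (expR x - 1); nra.
Qed.

Lemma gd_mono x y : x <= y -> gd x <= gd y.
Proof.
move=> xy; apply: (derive_ge0_le xy (df := fun x => 2 * expR x / (1 + expR x ^+ 2))).
- exact/continuous_subspaceT/continuous_gd.
- by move=> z _; exact: is_derive_gd.
- by move=> z _; have /andP[] := dgd_bounds z.
Qed.

Lemma gd_lip x y : `|gd x - gd y| <= `|x - y|.
Proof.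
wlog xy : x y / y <= x.
  by move=> H; have [/H//|/ltW/H] := leP y x; rewrite distrC (distrC y).
rewrite (ger0_norm (_ : 0 <= x - y)) ?subr_ge0//.
apply: (mvt_abs xy (df := fun x => 2 * expR x / (1 + expR x ^+ 2)) (p := id)
  (dp := fun=> 1)).
- exact/continuous_subspaceT/continuous_gd.
- by apply/continuous_subspaceT => z; exact: cvg_id.
- by move=> z _; exact: is_derive_gd.
- by move=> z _; have /andP[h0 h1] := dgd_bounds z; rewrite ger0_norm.
Qed.

Lemma gd0 : gd 0 = 0.
Proof. by rewrite /gd expR0 atan1; field. Qed.

(** The derivative 1 / cosh of gd is even, so gd x + gd (- x) is constant. *)
Lemma gdN x : gd (- x) = - gd x.
Proof.
wlog x0 : x / 0 <= x.
  move=> H; have [/H//|/ltW] := leP 0 x.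
  by rewrite -oppr_ge0 => /H; rewrite opprK => ->; rewrite opprK.
pose f := fun y => gd y + gd (- y).
have Df y : is_derive y 1 f 0.
  have -> : 0 = (2 * expR y / (1 + expR y ^+ 2)) +
    (2 * expR (- y) / (1 + expR (- y) ^+ 2)) * -1 :> R.
    rewrite expRN; have e0 := expR_gt0 y.
    have e2 : 0 < 1 + expR y ^+ 2 by nra.
    by field; rewrite addrC !gt_eqF.
  apply: is_deriveD; first exact: is_derive_gd.
  apply: is_derive1_comp; first exact: is_derive_gd.
have : `|f x - f 0| <= 0 - 0.
  apply: (mvt_abs (df := fun=> 0) (p := fun=> 0) (dp := fun=> 0) x0).
  - by apply: continuous_subspaceT => y; exact: is_derive_cont (Df y).
  - by apply: continuous_subspaceT => y; exact: cvg_cst.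
  - by move=> y _; rewrite normr0.
rewrite /f oppr0 gd0 addr0 !subr0 normr_le0 => /eqP; lra.
Qed.

Lemma gd_norm x : `|gd x| <= 2.
Proof.
have a0 : 0 < atan (expR x) by rewrite -(@atan0 R) lt_atan// expR_gt0.
have a1 := atan_ltpi2 (expR x); have [/andP[_ p4] _] := @pihalf_02_cos_pihalf R.
by rewrite /gd ler_norml; lra.
Qed.

(** For y in [0, 1/2] the derivative 1 / cosh y is at least
    exp (- y) >= 1 - y >= 1/2. *)
Lemma gd_ge x : 0 <= x <= 2^-1 -> x / 2 <= gd x.
Proof.
move=> /andP[x0 x1]; rewrite -subr_ge0.
have -> : 0 = gd 0 - 0 / 2 :> R by rewrite gd0; ring.
apply: (derive_ge0_le x0 (f := fun x => gd x - x / 2)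
  (df := fun x => 2 * expR x / (1 + expR x ^+ 2) - 2^-1)).
- apply/continuous_subspaceT => y.
  by apply: cvgB; [exact: continuous_gd|apply: cvgM => //; exact: cvg_cst].
- move=> y _; apply: is_deriveB; first exact: is_derive_gd.
  rewrite -[X in is_derive _ _ _ X]mulr1.
  under eq_fun do rewrite mulrC.
  exact: (is_deriveZ 2^-1).
move=> y /andP[y0 y1]; rewrite subr_ge0.
have e0 : 1 <= expR y by rewrite -expR0 ler_expR ltW.
have em := expR_ge1Dx (- y).
have E : expR y * expR (- y) = 1 by rewrite expRxMexpNx_1.
have e2 : expR y <= 2 by nra.
by rewrite ler_pdivlMr; nra.
Qed.

(** The even primitive of gd: the density of the potential of the flow. *)
Definition gdprim (x : R) : R := antider gd `|x|.

Lemma gdprim0 : gdprim 0 = 0.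
Proof. by rewrite /gdprim normr0 antider0. Qed.

Lemma gd_ge0 x : 0 <= x -> 0 <= gd x.
Proof. by move=> /gd_mono; rewrite gd0. Qed.

Lemma antider_gd_cont (a b : R) : 0 <= a -> {within `[a, b], continuous (antider gd)}.
Proof.
move=> a0; apply: continuous_in_subspaceT => x; rewrite inE/= in_itv/= => /andP[ax _].
apply: is_derive_cont; apply: is_derive_antider; first exact: continuous_gd.
exact: le_trans ax.
Qed.

Lemma within_continuous_id (a b : R) :
  {within `[a, b], continuous (fun z : R => z)}.
Proof. by apply: continuous_subspaceT => z; exact: cvg_id. Qed.

(** The tangent inequality at b. On the half line [0, +oo[ it is the monotonicity
    of gd; it passes to all of R because gd is odd and gdprim even, via
    gd b * a <= gd |b| * |a|. *)
Lemma gdprim_convex a b : gdprim b - gdprim a <= gd b * (b - a).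
Proof.
have ante x y : 0 <= x -> 0 <= y ->
    antider gd y - antider gd x <= gd y * (y - x).
  move=> x0 y0; have [xy|/ltW yx] := leP x y.
    rewrite -subr_ge0.
    have : gd y * x - antider gd x <= gd y * y - antider gd y; last by lra.
    apply: (derive_ge0_le xy (f := fun z => gd y * z - antider gd z)
       (df := fun z => gd y - gd z)).
    - move=> z; apply: cvgB; last exact: antider_gd_cont.
      by apply: cvgM; [exact: cvg_cst|exact: within_continuous_id].
    - move=> z /andP[xz _]; apply: is_deriveB.
        rewrite -[X in is_derive _ _ _ X]mulr1; exact: (is_deriveZ (gd y)).
      apply: is_derive_antider; first exact: continuous_gd.
      by rewrite (le_trans x0)// ltW.
    - by move=> z /andP[_ zy]; rewrite subr_ge0 gd_mono// ltW.
  have : antider gd y - gd y * y <= antider gd x - gd y * x; last by lra.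
  apply: (derive_ge0_le yx (f := fun z => antider gd z - gd y * z)
       (df := fun z => gd z - gd y)).
  - move=> z; apply: cvgB; first exact: antider_gd_cont.
    by apply: cvgM; [exact: cvg_cst|exact: within_continuous_id].
  - move=> z /andP[xz _]; apply: is_deriveB; last first.
      rewrite -[X in is_derive _ _ _ X]mulr1; exact: (is_deriveZ (gd y)).
    apply: is_derive_antider; first exact: continuous_gd.
    by rewrite (le_trans y0)// ltW.
  - by move=> z /andP[zy _]; rewrite subr_ge0 gd_mono// ltW.
apply: le_trans (ante _ _ (normr_ge0 a) (normr_ge0 b)) _.
have g0 := gd_ge0 (normr_ge0 b).
have := ler_norm a; have := ler_norm (- a); rewrite normrN => h1 h2.
have [b0|b0] := leP 0 b.
  by move: g0; rewrite (ger0_norm b0) => g0; nra.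
by move: g0; rewrite (ltr0_norm b0) gdN => g0; nra.
Qed.

Lemma gdprim_ge0 x : 0 <= gdprim x.
Proof. by have := gdprim_convex x 0; rewrite gdprim0 gd0; lra. Qed.

Lemma gdprim_le x : gdprim x <= x * gd x.
Proof. by have := gdprim_convex 0 x; rewrite gdprim0; lra. Qed.

Lemma normr_gd x : `|gd x| <= `|x|.
Proof. by have := gd_lip x 0; rewrite gd0 !subr0. Qed.

Lemma mul_gd_le x : x * gd x <= x ^+ 2.
Proof.
apply: le_trans (ler_norm _) _; rewrite normrM -real_normK ?num_real// expr2.
by rewrite ler_wpM2l// normr_gd.
Qed.

Lemma gdprim_ge x : `|x| <= 2^-1 -> x ^+ 2 / 4 <= gdprim x.
Proof.
move=> x1; rewrite -real_normK ?num_real// /gdprim.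
move: (normr_ge0 x) x1; move: `|x| => {}x x0 x1.
rewrite -subr_ge0.
have -> : 0 = antider gd 0 - 0 ^+ 2 / 4 :> R by rewrite antider0; ring.
apply: (derive_ge0_le x0 (f := fun x => antider gd x - x ^+ 2 / 4)
  (df := fun x => gd x - x / 2)).
- move=> z; apply: cvgB; first exact: antider_gd_cont.
  apply: (@continuous_subspaceT _ _ `[0, x] (fun y : R => y ^+ 2 / 4)) => y.
  by apply: cvgM; [exact: exprn_continuous|exact: cvg_cst].
- move=> y /andP[y0 _]; apply: is_deriveB.
    apply: is_derive_antider; first exact: continuous_gd.
    exact: ltW.
  under eq_fun do rewrite mulrC.
  have -> : y / 2 = 4^-1 * (2%:R * y ^+ 1 * 1) by rewrite expr1; field.
  exact: (is_deriveZ 4^-1 (is_deriveX 2 (is_derive_id y 1))).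
move=> y /andP[y0 y1]; rewrite subr_ge0; apply: gd_ge.
by rewrite !ltW// (lt_le_trans y1).
Qed.

(** With a right angle at the circle intersection the angle at v_i is acos (a / c),
    c the hypotenuse, which is atan (b / a). *)
Lemma theta_right_angle (a b : R) : 0 < a -> 0 < b ->
  2 * theta (pi / 2) a b - pi / 2 = gd (ln b - ln a).
Proof.
move=> a0 b0.
rewrite /gd -ln_div ?posrE// lnK ?posrE ?divr_gt0//; congr (2 * _ - _).
rewrite /theta /side_length /inner_angle cos_pihalf mulr0 addr0.
have y0 : 0 < b / a by rewrite divr_gt0.
have ab0 : 0 < a ^+ 2 + b ^+ 2 by nra.
set c := Num.sqrt _.
have c0 : 0 < c by rewrite sqrtr_gt0.
have cE : c ^+ 2 = a ^+ 2 + b ^+ 2 by rewrite sqr_sqrtr// ltW.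
have -> : (a ^+ 2 + c ^+ 2 - b ^+ 2) / (2 * a * c) = cos (atan (b / a)).
  rewrite cos_atan.
  have -> : 1 + (b / a) ^+ 2 = (c / a) ^+ 2.
    by rewrite !expr_div_n cE; field; rewrite gt_eqF.
  rewrite sqrtr_sqr gtr0_norm ?divr_gt0//. rewrite cE.
  by field; rewrite !gt_eqF.
rewrite cosK// in_itv/= -[0](@atan0 R).
rewrite le_atan ?ltW//=.
have := atan_ltpi2 (b / a); have := @pi_gt0 R; lra.
Qed.

End Gudermann.

(** * The velocity field *)

Section Velocity.
Context {R : realType}.
Implicit Types (u w : lattice -> R) (i : lattice).

Definition east i : lattice := (i.1 + 1, i.2).
Definition west i : lattice := (i.1 - 1, i.2).
Definition north i : lattice := (i.1, i.2 + 1).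
Definition south i : lattice := (i.1, i.2 - 1).

Lemma eastK : cancel east west.
Proof. by case=> a b; rewrite /east /west/= addrK. Qed.
Lemma westK : cancel west east.
Proof. by case=> a b; rewrite /east /west/= subrK. Qed.
Lemma northK : cancel north south.
Proof. by case=> a b; rewrite /north /south/= addrK. Qed.
Lemma southK : cancel south north.
Proof. by case=> a b; rewrite /north /south/= subrK. Qed.

Definition velocity u i : R :=
  gd (u (east i) - u i) + gd (u (west i) - u i) +
  gd (u (north i) - u i) + gd (u (south i) - u i).

Definition dx u i : R := u (east i) - u i.
Definition dy u i : R := u (north i) - u i.

(** As gd is odd, the velocity is the discrete divergence of gd of the gradient. *)
Lemma velocityE u i : velocity u i =
  (gd (dx u i) - gd (dx u (west i))) + (gd (dy u i) - gd (dy u (south i))).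
Proof.
rewrite /dx /dy westK southK -!gdN !opprB /velocity; ring.
Qed.

(** The integer solutions of p^2 + q^2 = 1 are the four unit vectors. *)
Lemma neighbours i :
  [set j | Defs.adjacent j i] = [set` [:: east i; west i; north i; south i]].
Proof.
case: i => a b; apply/seteqP; split => -[x y]; rewrite /Defs.adjacent/=.
  rewrite !inE /east /west /north /south/= !xpair_eqE => H.
  have : [\/ x - a = 1 /\ y - b = 0, x - a = -1 /\ y - b = 0,
    x - a = 0 /\ y - b = 1 | x - a = 0 /\ y - b = -1].
    move: H; rewrite !expr2; move: (x - a) (y - b) => p q H.
    have p2 : 0 <= p * p by rewrite -expr2 sqr_ge0.
    have q2 : 0 <= q * q by rewrite -expr2 sqr_ge0.
    have bd (c d : int) : c * c + d * d = 1 -> 0 <= d * d -> c < 2.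
      by move=> h h2; have [//|h3] := ltP c 2; nia.
    have p3 : p < 2 by exact: bd H q2.
    have p4 : - p < 2 by apply: (bd _ q); rewrite ?mulrNN.
    have q3 : q < 2 by apply: (bd _ p) => //; rewrite addrC.
    have q4 : - q < 2 by apply: (bd _ p) => //; rewrite ?mulrNN addrC.
    have Ep : p = -1 \/ p = 0 \/ p = 1 by lia.
    have Eq : q = -1 \/ q = 0 \/ q = 1 by lia.
    case: Ep H => [->|[->|->]]; case: Eq => [->|[->|->]] => // _;
      by [constructor 1|constructor 2|constructor 3|constructor 4].
  by case=> -[h1 h2]; apply/or4P; [constructor 1|constructor 2|constructor 3|
    constructor 4]; apply/andP; split; apply/eqP; lia.
rewrite !inE /east /west /north /south/= !xpair_eqE.
by move=> /or4P[] /andP[/eqP -> /eqP ->]; ring.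
Qed.

Lemma neighbours_uniq i : uniq [:: east i; west i; north i; south i].
Proof.
case: i => a b; rewrite /= !inE /east /west /north /south/= !xpair_eqE.
by rewrite !negb_or !negb_and -!andbA; apply/and5P; split; lia.
Qed.

Lemma curvature_right_angle (r : lattice -> R) i : (forall j, 0 < r j) ->
  curvature (fun _ _ => pi / 2) r i = - velocity (fun j => ln (r j)) i.
Proof.
move=> r0; rewrite /curvature neighbours -fsbig_seq ?neighbours_uniq//.
rewrite !big_cons big_nil/= addr0 /velocity -!theta_right_angle//.
by field.
Qed.

Lemma gd_diff_le a b c d (M : R) : `|a - c| <= M -> `|b - d| <= M ->
  `|gd (a - b) - gd (c - d)| <= 2 * M.
Proof.
move=> ac bd; apply: le_trans (gd_lip _ _) _.
move: ac bd; rewrite !ler_norml => /andP[? ?] /andP[? ?]; apply/andP; split; lra.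
Qed.

Lemma velocity_lip_sup u w (M : R) i : (forall j, `|u j - w j| <= M) ->
  `|velocity u i - velocity w i| <= 8 * M.
Proof.
move=> uw.
have H j k : `|gd (u j - u k) - gd (w j - w k)| <= 2 * M by exact: gd_diff_le.
have := H (east i) i; have := H (west i) i; have := H (north i) i.
have := H (south i) i; rewrite /velocity !ler_norml.
move=> /andP[? ?] /andP[? ?] /andP[? ?] /andP[? ?]; apply/andP; split; lra.
Qed.

(** This bound, independent of u, is what makes uniqueness hold among all
    solutions. *)
Lemma velocity_norm u i : `|velocity u i| <= 8.
Proof.
have := gd_norm (u (east i) - u i); have := gd_norm (u (west i) - u i).
have := gd_norm (u (north i) - u i); have := gd_norm (u (south i) - u i).
rewrite /velocity !ler_norml.
move=> /andP[? ?] /andP[? ?] /andP[? ?] /andP[? ?]; apply/andP; split; lra.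
Qed.

Definition l2 u := summ (fun i => u i ^+ 2).
Definition nsq u : R := total (fun i => u i ^+ 2).

Lemma nsq_ge0 u : 0 <= nsq u.
Proof. by apply: total_ge0 => i; exact: sqr_ge0. Qed.

Lemma l2_le u w : (forall i, `|u i| <= `|w i|) -> l2 w -> l2 u /\ nsq u <= nsq w.
Proof.
move=> uw lw.
have H i : u i ^+ 2 <= w i ^+ 2.
  by rewrite -[u i ^+ 2]real_normK ?num_real// -[w i ^+ 2]real_normK ?num_real//
    ler_sqr ?nnegrE.
have lu : l2 u by apply: summ_le lw => i; rewrite ger0_norm ?sqr_ge0.
by split=> //; exact: total_le.
Qed.

Lemma l2_shift h k u : cancel h k -> l2 u -> l2 (u \o h).
Proof. by move=> hk lu; exact: (summ_reindex hk lu). Qed.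

Lemma l2D u w : l2 u -> l2 w -> l2 (fun i => u i + w i).
Proof.
move=> lu lw; apply: (@summ_le _ _ (fun i => 2 * u i ^+ 2 + 2 * w i ^+ 2)).
  move=> i; rewrite ger0_norm ?sqr_ge0//.
  by have := sqr_ge0 (u i - w i); nra.
by apply: summD; apply: summZ.
Qed.

Lemma l2N u : l2 u -> l2 (fun i => - u i).
Proof. by apply: summ_le => i; rewrite sqrrN ger0_norm ?sqr_ge0. Qed.

Lemma l2B u w : l2 u -> l2 w -> l2 (fun i => u i - w i).
Proof. by move=> lu /l2N; exact: l2D. Qed.

Lemma l2Z (c : R) u : l2 u -> l2 (fun i => c * u i).
Proof.
move=> lu; rewrite /l2; under eq_fun do rewrite exprMn.
exact: summZ.
Qed.

Lemma nsqZ (c : R) u : l2 u -> nsq (fun i => c * u i) = c ^+ 2 * nsq u.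
Proof.
by move=> lu; rewrite /nsq; under eq_fun do rewrite exprMn; rewrite totalZ.
Qed.

Lemma summM u w : l2 u -> l2 w -> summ (fun i => u i * w i).
Proof.
move=> lu lw; apply: (@summ_le _ _ (fun i => u i ^+ 2 + w i ^+ 2)); last exact: summD.
move=> i; rewrite ler_norml.
by have := sqr_ge0 (u i - w i); have := sqr_ge0 (u i + w i); nra.
Qed.

Lemma l2_dx u : l2 u -> l2 (dx u).
Proof. by move=> lu; apply: l2B => //; exact: l2_shift eastK lu. Qed.

Lemma l2_dy u : l2 u -> l2 (dy u).
Proof. by move=> lu; apply: l2B => //; exact: l2_shift northK lu. Qed.

Lemma l2_gd u : l2 u -> l2 (fun i => gd (u i)).
Proof. by move=> lu; have [] := l2_le (fun i => normr_gd (u i)) lu. Qed.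

Lemma nsq_dx_le u : l2 u -> nsq (dx u) + nsq (dy u) <= 8 * nsq u.
Proof.
move=> lu.
have H h k : cancel h k -> cancel k h -> nsq (fun i => u (h i) - u i) <= 4 * nsq u.
  move=> hk kh.
  have lh : l2 (u \o h) by exact: l2_shift hk lu.
  apply: (@le_trans _ _ (total (fun i => 2 * u (h i) ^+ 2 + 2 * u i ^+ 2))).
    apply: total_le.
    - exact: l2B.
    - by apply: summD; apply: summZ.
    - by move=> i; have := sqr_ge0 (u (h i) + u i); nra.
  rewrite totalD ?totalZ//; do 1?[exact: summZ].
  rewrite (total_reindex hk kh lu) -/(nsq u); lra.
by have := H _ _ eastK westK; have := H _ _ northK southK; rewrite /dx /dy; lra.
Qed.

(** The constant is 64 = 8^2: each of the four squared differences costs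
    2 d_j^2 + 2 d_i^2, Cauchy-Schwarz for four terms costs a factor 4, and
    translation invariance replaces every shifted sum by nsq d. *)
Lemma velocity_lip_l2 u w : l2 (fun i => u i - w i) ->
  l2 (fun i => velocity u i - velocity w i) /\
  nsq (fun i => velocity u i - velocity w i) <= 64 * nsq (fun i => u i - w i).
Proof.
set d := fun i => u i - w i => ld.
have sh h k : cancel h k -> summ (fun i => d (h i) ^+ 2).
  by move=> hk; exact: (l2_shift hk ld).
pose B i := 8 * (d (east i) ^+ 2 + d (west i) ^+ 2 + d (north i) ^+ 2
  + d (south i) ^+ 2) + 32 * d i ^+ 2.
have s4 : summ (fun i => d (east i) ^+ 2 + d (west i) ^+ 2 + d (north i) ^+ 2
  + d (south i) ^+ 2).
  apply: summD; last exact: sh southK.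
  apply: summD; last exact: sh northK.
  by apply: summD; [exact: sh eastK|exact: sh westK].
have sB : summ B by apply: summD; apply: summZ.
have tB : total B = 64 * nsq d.
  have te h k : cancel h k -> cancel k h -> total (fun i => d (h i) ^+ 2) = nsq d.
    by move=> hk kh; exact: (total_reindex hk kh ld).
  rewrite /B totalD; [|exact: summZ|exact: summZ].
  rewrite !totalZ// totalD; [|
    by do 2?[apply: summD]; [exact: sh eastK|exact: sh westK|exact: sh northK]
    |exact: sh southK].
  rewrite totalD; [|by apply: summD; [exact: sh eastK|exact: sh westK]|exact: sh northK].
  rewrite totalD; [|exact: sh eastK|exact: sh westK].
  rewrite (te _ _ eastK westK) (te _ _ westK eastK) (te _ _ northK southK).
  by rewrite (te _ _ southK northK) -/(nsq d); ring.
have FB i : (velocity u i - velocity w i) ^+ 2 <= B i.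
  have g j : `|gd (u j - u i) - gd (w j - w i)| <= `|d j - d i|.
    apply: le_trans (gd_lip _ _) _.
    by rewrite le_eqVlt; apply/orP; left; apply/eqP; congr `|_|; rewrite /d; ring.
  have g2 j : (gd (u j - u i) - gd (w j - w i)) ^+ 2 <= 2 * d j ^+ 2 + 2 * d i ^+ 2.
    apply: (@le_trans _ _ ((d j - d i) ^+ 2)).
      by rewrite -real_normK ?num_real// -[leRHS]real_normK ?num_real//
        ler_sqr ?nnegrE.
    by have := sqr_ge0 (d j + d i); nra.
  have := g2 (east i); have := g2 (west i); have := g2 (north i).
  have := g2 (south i); rewrite /velocity /B.
  set a1 := gd _ - gd _; set a2 := gd _ - gd _; set a3 := gd _ - gd _.
  set a4 := gd _ - gd _ => h4 h3 h2 h1.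
  have -> : gd (u (east i) - u i) + gd (u (west i) - u i) +
   gd (u (north i) - u i) + gd (u (south i) - u i) -
   (gd (w (east i) - w i) + gd (w (west i) - w i) +
    gd (w (north i) - w i) + gd (w (south i) - w i)) = a4 + a3 + a2 + a1.
    by rewrite /a1 /a2 /a3 /a4; ring.
  have := sqr_ge0 (a1 - a2); have := sqr_ge0 (a1 - a3); have := sqr_ge0 (a1 - a4).
  have := sqr_ge0 (a2 - a3); have := sqr_ge0 (a2 - a4); have := sqr_ge0 (a3 - a4).
  nra.
have lF : l2 (fun i => velocity u i - velocity w i).
  by apply: summ_le sB => i; rewrite ger0_norm ?sqr_ge0.
by split => //; rewrite -tB; apply: total_le.
Qed.

Lemma velocity0 i : velocity (fun=> 0) i = 0.
Proof. by rewrite /velocity subrr gd0; ring. Qed.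

Lemma velocity_l2 u : l2 u -> l2 (velocity u) /\ nsq (velocity u) <= 64 * nsq u.
Proof.
move=> lu; have := @velocity_lip_l2 u (fun=> 0).
have -> : (fun i => u i - (fun=> 0) i) = u by apply/funext => i; rewrite subr0.
have -> : (fun i => velocity u i - velocity (fun=> 0) i) = velocity u.
  by apply/funext => i; rewrite velocity0 subr0.
exact.
Qed.

(** The weak form of the equation: the velocity is minus the l^2-gradient of the
    potential whose density is the primitive of gd. *)
Lemma velocity_by_parts u w : l2 u -> l2 w ->
  total (fun i => w i * velocity u i) =
  - (total (fun i => dx w i * gd (dx u i)) + total (fun i => dy w i * gd (dy u i))).
Proof.
move=> lu lw.
have one h k p : cancel h k -> cancel k h -> l2 p ->
    summ (fun i => w i * (p i - p (k i))) /\
    total (fun i => w i * (p i - p (k i))) = - total (fun i => (w (h i) - w i) * p i).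
  move=> hk kh lp.
  have lpk : l2 (p \o k) by exact: l2_shift kh lp.
  have lwh : l2 (w \o h) by exact: l2_shift hk lw.
  have s1 : summ (fun i => w i * p i) by exact: summM.
  have s2 : summ (fun i => w i * p (k i)) by exact: summM.
  have s3 : summ (fun i => w (h i) * p i) by exact: (summM lwh lp).
  have e1 : (fun i => w i * (p i - p (k i))) = (fun i => w i * p i + - (w i * p (k i))).
    by apply/funext => i; ring.
  have e2 : (fun i => (w (h i) - w i) * p i) = (fun i => w (h i) * p i + - (w i * p i)).
    by apply/funext => i; ring.
  rewrite e1 e2; split; first by apply: summD => //; exact: summN.
  rewrite !totalD//; do 1?[exact: summN].
  rewrite !totalN// -(total_reindex hk kh s2).
  have -> : (fun i => w i * p (k i)) \o h = fun i => w (h i) * p i.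
    by apply/funext => i /=; rewrite hk.
  by ring.
have [sx ex] := one _ _ _ eastK westK (l2_gd (l2_dx lu)).
have [sy ey] := one _ _ _ northK southK (l2_gd (l2_dy lu)).
have -> : (fun i => w i * velocity u i) =
  (fun i => w i * (gd (dx u i) - gd (dx u (west i))) +
            w i * (gd (dy u i) - gd (dy u (south i)))).
  by apply/funext => i; rewrite velocityE mulrDr.
by rewrite totalD// ex ey opprD.
Qed.

End Velocity.

(** * Existence and uniqueness of the flow *)

Section Flow.
Context {R : realType}.
Implicit Types (u v : R -> lattice -> R) (i : lattice).

(** The form in which geometric convergence is used: every iteration below gains
    a factor 1/2. *)
Lemma eq0_of_halves (a c : R) : (forall n, `|a| <= c * 2^-1 ^+ n) -> a = 0.
Proof.
move=> H; apply/eqP; rewrite -normr_eq0 -[_ == 0]negbK -normr_gt0 normr_id.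
apply/negP => a0.
have := archi_boundP (_ : 0 <= c / `|a|).
have c0 : 0 <= c by have := H 0%N; rewrite expr0 mulr1; exact: le_trans.
move=> /(_ (divr_ge0 c0 (ltW a0))); rewrite ltr_pdivrMr//.
set n := Num.bound _ => cn.
have := H n; rewrite exprVn ler_pdivlMr ?exprn_gt0//.
have : n%:R <= 2 ^+ n :> R by rewrite -natrX ler_nat ltnW// ltn_expl.
by rewrite -(ler_pM2l a0) => h1 h2; move: cn; lra.
Qed.

(** x n - 2 c / 2^n increases and x n + 2 c / 2^n decreases; the limit is the
    supremum of the former. *)
Lemma cauchy_halves (x : nat -> R) (c : R) :
  (forall n, `|x n.+1 - x n| <= c * 2^-1 ^+ n) ->
  exists l, forall n, `|x n - l| <= 2 * c * 2^-1 ^+ n.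
Proof.
move=> H.
pose d n := c * 2^-1 ^+ n.
have dS n : d n.+1 = d n / 2 by rewrite /d exprSr mulrA.
pose a n := x n - 2 * d n; pose b n := x n + 2 * d n.
have aS n : a n <= a n.+1.
  by have := H n; rewrite -/(d n) ler_norml /a dS => /andP[]; lra.
have bS n : b n.+1 <= b n.
  by have := H n; rewrite -/(d n) ler_norml /b dS => /andP[]; lra.
have d0 n : 0 <= d n by exact: le_trans (H n).
have am : {homo a : n m / (n <= m)%N >-> n <= m}.
  by apply: homo_leq => //; exact: le_trans.
have bm : {homo b : n m / (n <= m)%N >-> m <= n}.
  by apply: homo_leq => // ? ? ? ? h; exact: le_trans h _.
have ab n m : a n <= b m.
  apply: (le_trans (am _ _ (leq_maxl n m))).
  apply: le_trans (bm _ _ (leq_maxr n m)).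
  by rewrite /a /b; have := d0 (maxn n m); lra.
have hs : has_sup (range a).
  split; first by exists (a 0%N), 0%N.
  by exists (b 0%N) => _ [n _ <-].
exists (sup (range a)) => n.
have h1 : a n <= sup (range a) by apply: sup_upper_bound => //; exists n.
have h2 : sup (range a) <= b n.
  by apply: ge_sup; [exists (a 0%N), 0%N|move=> _ [m _ <-]].
by rewrite -mulrA -/(d n) ler_norml; rewrite /a /b in h1 h2; lra.
Qed.

Lemma is_derive_exp (c k t : R) :
  is_derive t 1 (fun s => c * expR (k * s)) (c * k * expR (k * t)).
Proof.
rewrite -mulrA [k * _]mulrC.
apply: (is_deriveZ c).
apply: is_derive1_comp.
rewrite -[X in is_derive _ _ _ X]mulr1.
exact: (is_deriveZ k).
Qed.

Lemma continuous_exp (c k a b : R) :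
  {within `[a, b], continuous (fun s => c * expR (k * s))}.
Proof.
apply: continuous_subspaceT => t.
exact: is_derive_cont (is_derive_exp c k t).
Qed.

Lemma continuous_normr_comp (f : R -> R) :
  (forall t, 0 <= t -> {for t, continuous f}) -> continuous (fun s : R => f `|s|).
Proof.
move=> cf s; apply: continuous_comp; first exact: norm_continuous.
exact: cf.
Qed.

Lemma within_continuous_ge0 (f : R -> R) (a b : R) :
  0 <= a -> (forall t, 0 <= t -> {for t, continuous f}) ->
  {within `[a, b], continuous f}.
Proof.
move=> a0 cf; apply: continuous_in_subspaceT => x.
rewrite inE/= in_itv/= => /andP[ax _].
by apply: cf; exact: le_trans ax.
Qed.

Lemma continuous_velocity v i : (forall j, continuous (v^~ j)) ->
  continuous (fun s => velocity (v s) i).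
Proof.
move=> cv s.
have c j k : {for s, continuous (fun s => gd (v s j - v s k))}.
  apply: (@continuous_comp _ _ _ (fun s => v s j - v s k) gd).
    by apply: cvgB; exact: cv.
  exact: continuous_gd.
exact: (cvgD (cvgD (cvgD (c (east i) i) (c (west i) i)) (c (north i) i))
  (c (south i) i)).
Qed.

Lemma mvt_l2_total v (dv : R -> lattice -> R) (p dp : R -> R) (a b : R) :
  a <= b ->
  (forall i, {within `[a, b], continuous (v^~ i)}) ->
  {within `[a, b], continuous p} ->
  (forall x i, a < x < b -> is_derive x 1 (v^~ i) (dv x i)) ->
  (forall x, a < x < b -> is_derive x 1 p (dp x)) ->
  (forall x, a < x < b -> 0 < dp x) ->
  (forall x, a < x < b -> l2 (dv x) /\ nsq (dv x) <= dp x ^+ 2) ->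
  l2 (fun i => v b i - v a i) /\
  nsq (fun i => v b i - v a i) <= (p b - p a) ^+ 2.
Proof.
move=> ab cv cp Dv Dp dp0 H.
apply: summ_total_le => [i|s us]; first exact: sqr_ge0.
apply: (mvt_l2 (df := dv) ab cv cp Dv Dp dp0) => x xab.
have [l le] := H x xab; apply: le_trans le.
by apply: total_ge_seq => // i; exact: sqr_ge0.
Qed.

(** Derivatives are two-sided even at t = 0: the solutions constructed below extend
    to slightly negative times. *)
Definition solution v :=
  forall t : R, 0 <= t -> forall i, is_derive t 1 (v^~ i) (velocity (v t) i).

Section Picard.
Variable u0 : lattice -> R.

(** Evaluating the previous iterate at |s| makes the integrand continuous on all
    of R, although the iterates are only controlled for nonnegative times. *)
Fixpoint picard n (t : R) i : R :=
  if n is n'.+1 then u0 i + antider (fun s => velocity (picard n' `|s|) i) t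
  else u0 i.

Lemma picard0 n i : picard n 0 i = u0 i.
Proof. by case: n => //= n; rewrite antider0 addr0. Qed.

Lemma is_derive_shift_antider f (c t : R) : continuous f -> 0 <= t ->
  is_derive t 1 (fun s => c + antider f s) (f t).
Proof.
move=> cf t0; rewrite -[f t]add0r; apply: is_deriveD.
exact: is_derive_antider.
Qed.

Lemma picard_cont n i (t : R) : 0 <= t -> {for t, continuous (picard n ^~ i)}.
Proof.
elim: n i t => [|n IH] i t t0; first exact: cvg_cst.
apply: is_derive_cont (is_derive_shift_antider _ _ t0).
by apply: (@continuous_velocity (fun s => picard n `|s|)) => j;
  apply: continuous_normr_comp (IH j).
Qed.

Lemma picard_derive n i (t : R) : 0 <= t ->
  is_derive t 1 (picard n.+1 ^~ i) (velocity (picard n t) i).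
Proof.
move=> t0; rewrite -{2}(ger0_norm t0).
apply: (is_derive_shift_antider (f := fun s => velocity (picard n `|s|) i)) => //.
by apply: (@continuous_velocity (fun s => picard n `|s|)) => j;
  apply: continuous_normr_comp (@picard_cont n j).
Qed.

(** Against the weight exp (16 t) the Picard map contracts by 1/2: the Lipschitz
    constant 8 is divided by the rate 16 upon integration. *)
Lemma picard_step n (t : R) i : 0 <= t ->
  `|picard n.+1 t i - picard n t i| <= expR (16 * t) * 2^-1 ^+ n.
Proof.
elim: n t i => [|n IH] t i t0.
  rewrite expr0 mulr1.
  have : `|picard 1 t i - picard 1 0 i| <= 1 * expR (16 * t) - 1 * expR (16 * 0).
    apply: (mvt_abs t0 (f := picard 1 ^~ i) (df := fun s => velocity (picard 0 s) i)
      (p := fun s => 1 * expR (16 * s)) (dp := fun s => 1 * 16 * expR (16 * s))).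
    - by apply: within_continuous_ge0 => // s; exact: picard_cont.
    - exact: continuous_exp.
    - by move=> s /andP[s0 _]; apply: picard_derive; exact: ltW.
    - by move=> s _; exact: is_derive_exp.
    move=> s /andP[s0 _]; apply: le_trans (velocity_norm _ _) _.
    have : 1 <= expR (16 * s) by rewrite -expR0 ler_expR mulr_ge0// ltW.
    lra.
  by rewrite picard0 mulr0 expR0; lra.
pose c : R := 2^-1 ^+ n.+1.
have c0 : 0 < c by rewrite exprn_gt0.
have : `|(picard n.+2 t i - picard n.+1 t i) - (picard n.+2 0 i - picard n.+1 0 i)|
   <= c * expR (16 * t) - c * expR (16 * 0).
  apply: (mvt_abs t0 (f := fun s => picard n.+2 s i - picard n.+1 s i)
    (df := fun s => velocity (picard n.+1 s) i - velocity (picard n s) i)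
    (p := fun s => c * expR (16 * s)) (dp := fun s => c * 16 * expR (16 * s))).
  - apply: within_continuous_ge0 => // s s0.
    by apply: cvgB; exact: picard_cont.
  - exact: continuous_exp.
  - by move=> s /andP[s0 _]; apply: is_deriveB; apply: picard_derive; exact: ltW.
  - by move=> s _; exact: is_derive_exp.
  move=> s /andP[s0 _].
  apply: le_trans (velocity_lip_sup _ (fun j => IH s j (ltW s0))) _.
  by rewrite /c exprSr; lra.
rewrite !picard0 subrr subr0 mulr0 expR0 => /le_trans; apply.
by rewrite -/c; lra.
Qed.

Lemma picard_lip n (s t : R) i : 0 <= s -> 0 <= t ->
  `|picard n t i - picard n s i| <= 8 * `|t - s|.
Proof.
wlog st : s t / s <= t.
  move=> H s0 t0; have [/H|/ltW/H] := leP s t; first exact.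
  by rewrite distrC (distrC t); exact.
move=> s0 t0; case: n => [|n]; first by rewrite /= subrr normr0 mulr_ge0.
rewrite (ger0_norm (_ : 0 <= t - s)) ?subr_ge0// mulrBr.
apply: (mvt_abs st (f := picard n.+1 ^~ i) (df := fun s => velocity (picard n s) i)
      (p := fun s => 8 * s) (dp := fun s => 8)).
- by apply: within_continuous_ge0 => // x; exact: picard_cont.
- by apply: continuous_subspaceT => x; apply: cvgM; [exact: cvg_cst|exact: cvg_id].
- by move=> x /andP[sx _]; apply: picard_derive; rewrite ltW// (le_lt_trans s0).
- move=> x _; rewrite -[X in is_derive _ _ _ X]mulr1; exact: (is_deriveZ 8).
- by move=> x _; exact: velocity_norm.
Qed.

(** The bound is reproduced by the Picard map. If the iterate has norm at most
    2 M exp (16 t), then the next one differs from u0 by at most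
    M (exp (16 t) - 1), and |u0 + d|^2 <= 2 |u0|^2 + 2 |d|^2
    <= 2 M^2 + 2 M^2 (exp (16 t) - 1)^2 <= (2 M exp (16 t))^2. *)
Lemma picard_l2 (M : R) n (t : R) : 0 < M -> l2 u0 -> nsq u0 <= M ^+ 2 -> 0 <= t ->
  l2 (picard n t) /\ nsq (picard n t) <= (2 * M * expR (16 * t)) ^+ 2.
Proof.
move=> M0 lu nu; elim: n t => [|n IH] t t0.
  split=> //; apply: le_trans nu _.
  have : 1 <= expR (16 * t) by rewrite -expR0 ler_expR mulr_ge0.
  by move=> e1; rewrite ler_sqr ?nnegrE; nra.
have [] := @mvt_l2_total (picard n.+1) (fun s => velocity (picard n s))
  (fun s => M * expR (16 * s)) (fun s => M * 16 * expR (16 * s)) 0 t t0.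
- by move=> i; apply: within_continuous_ge0 => // s; exact: picard_cont.
- exact: continuous_exp.
- by move=> s i /andP[s0 _]; apply: picard_derive; exact: ltW.
- by move=> s _; exact: is_derive_exp.
- by move=> s _; rewrite !mulr_gt0 ?expR_gt0.
- move=> s /andP[s0 _]; have [l1 l3] := IH s (ltW s0).
  have [l4 l5] := velocity_l2 l1; split => //; apply: le_trans l5 _.
  by rewrite !exprMn in l3 *; lra.
under [fun i => _ - _]eq_fun do rewrite picard0.
rewrite mulr0 expR0; set d := (fun i => _) => ld nd.
have E : picard n.+1 t = fun i => u0 i + d i.
  by apply/funext => i; rewrite /d addrC subrK.
rewrite E; split; first exact: l2D.
apply: (@le_trans _ _ (2 * nsq u0 + 2 * nsq d)).
  rewrite /nsq -!totalZ// -totalD; [|exact: summZ|exact: summZ].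
  apply: total_le; [exact: l2D|by apply: summD; exact: summZ|].
  by move=> i; have := sqr_ge0 (u0 i - d i); nra.
have e1 : 1 <= expR (16 * t) by rewrite -expR0 ler_expR mulr_ge0.
move: nd; rewrite mulr1; move: (expR (16 * t)) e1 => e e1 nd; nra.
Qed.

(** The pointwise limit L of the iterates is Lipschitz in time, so its velocity
    has a primitive u; comparing u with the iterates through the derivatives
    shows u = L. The l^2 bound passes to the limit in finite sums. *)
Lemma exists_solution (M : R) : 0 < M -> l2 u0 -> nsq u0 <= M ^+ 2 ->
  exists u, [/\ u 0 = u0, solution u & forall t : R, 0 <= t -> l2 (u t) /\
    nsq (u t) <= (2 * M * expR (16 * t)) ^+ 2].
Proof.
move=> M0 lu nu.
have [L HL] : exists L : R -> lattice -> R, forall (t : R) i, 0 <= t ->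
    forall n, `|picard n t i - L t i| <= 2 * expR (16 * t) * 2^-1 ^+ n.
  have /choice[L HL] : forall q : R * lattice, exists l : R, 0 <= q.1 -> forall n,
     `|picard n q.1 q.2 - l| <= 2 * expR (16 * q.1) * 2^-1 ^+ n.
    move=> [t i]/=; have [t0|t0] := leP 0 t; last by exists 0.
    by have [l Hl] := cauchy_halves (fun n => picard_step n i t0); exists l.
  by exists (fun t i => L (t, i)) => t i; exact: HL (t, i).
have Llip (s t : R) i : 0 <= s -> 0 <= t -> `|L t i - L s i| <= 8 * `|t - s|.
  move=> s0 t0; rewrite -subr_le0; set a := _ - _.
  have Ha n : a <= (2 * expR (16 * t) + 2 * expR (16 * s)) * 2^-1 ^+ n.
    have := HL t i t0 n; have := HL s i s0 n; have := picard_lip n i s0 t0.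
    rewrite /a; set r := _ * `|_| => h1 h2 h3; rewrite lerBlDr.
    have -> : L t i - L s i = (picard n t i - picard n s i) +
      (picard n s i - L s i) - (picard n t i - L t i) by ring.
    apply: le_trans (ler_normB _ _) _.
    have := ler_normD (picard n t i - picard n s i) (picard n s i - L s i).
    lra.
  have [//|a0] := leP a 0.
  suff : a = 0 by move=> a1; move: a0; rewrite a1 ltxx.
  apply: eq0_of_halves => n; rewrite gtr0_norm//; exact: Ha.
have Lcont i : continuous (fun s : R => L `|s| i).
  move=> s; apply/cvgrPdist_le => e e0.
  near=> x.
  apply: le_trans (Llip _ _ i (normr_ge0 _) (normr_ge0 _)) _.
  apply: (@le_trans _ _ (8 * `|s - x|)); first by rewrite ler_pM2l// ler_dist_dist.
  rewrite mulrC -ler_pdivlMr//; near: x.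
  by apply: cvgr_dist_le; [exact: cvg_id|rewrite divr_gt0].
have Fcont i : continuous (fun s : R => velocity (L `|s|) i).
  by apply: (@continuous_velocity (fun s => L `|s|)) => j; exact: Lcont.
pose u t i := u0 i + antider (fun s => velocity (L `|s|) i) t.
have Du (t : R) i : 0 <= t -> is_derive t 1 (u^~ i) (velocity (L t) i).
  move=> t0; rewrite -{2}(ger0_norm t0).
  exact: (is_derive_shift_antider (f := fun s => velocity (L `|s|) i)).
have u00 i : u 0 i = u0 i by rewrite /u antider0 addr0.
have uL (t : R) : 0 <= t -> u t = L t.
  move=> t0; apply/funext => i; apply/eqP; rewrite -subr_eq0; apply/eqP.
  apply: (@eq0_of_halves _ (2 * expR (16 * t))) => n.
  pose c : R := 2^-1 ^+ n.
  have c0 : 0 < c by rewrite exprn_gt0.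
  have : `|(picard n.+1 t i - u t i) - (picard n.+1 0 i - u 0 i)|
     <= c * expR (16 * t) - c * expR (16 * 0).
    apply: (mvt_abs t0 (f := fun s => picard n.+1 s i - u s i)
      (df := fun s => velocity (picard n s) i - velocity (L s) i)
      (p := fun s => c * expR (16 * s)) (dp := fun s => c * 16 * expR (16 * s))).
    - apply: within_continuous_ge0 => // s s0.
      by apply: cvgB; [exact: picard_cont|exact: is_derive_cont (Du s i s0)].
    - exact: continuous_exp.
    - move=> s /andP[/ltW s0 _]; apply: is_deriveB; [exact: picard_derive|exact: Du].
    - by move=> s _; exact: is_derive_exp.
    move=> s /andP[/ltW s0 _].
    apply: le_trans (velocity_lip_sup _ (fun j => HL s j s0 n)) _.
    by rewrite -/c; lra.
  rewrite picard0 u00 subrr subr0 mulr0 expR0 => h1.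
  have := HL t i t0 n.+1; rewrite exprSr -/c => h2.
  have -> : u t i - L t i = (picard n.+1 t i - L t i) - (picard n.+1 t i - u t i).
    by ring.
  by apply: le_trans (ler_normB _ _) _; lra.
exists u; split => [|t t0 i|t t0].
- exact/funext.
- by rewrite uL//; exact: Du.
rewrite uL//; apply: summ_total_le => [i|s us]; first exact: sqr_ge0.
have cvgL i : picard n t i @[n --> \oo] --> L t i.
  apply/cvgrPdist_le => e e0.
  have h : (2 * expR (16 * t)) * 2^-1 ^+ n @[n --> \oo] --> (0 : R).
    rewrite -(mulr0 (2 * expR (16 * t))); apply: cvgM; first exact: cvg_cst.
    by apply: cvg_expr; rewrite ger0_norm; lra.
  move/cvgrPdist_le : h => /(_ _ e0); apply: filterS => n.
  rewrite sub0r normrN => h; rewrite distrC.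
  by apply: le_trans (HL t i t0 n) _; apply: le_trans h; exact: ler_norm.
have : (\sum_(i <- s) picard n t i ^+ 2) @[n --> \oo] -->
    \sum_(i <- s) L t i ^+ 2.
  elim: s {us} => [|i s IH].
    by rewrite big_nil; under eq_fun do rewrite big_nil; exact: cvg_cst.
  rewrite big_cons; under eq_fun do rewrite big_cons.
  by apply: cvgD => //; rewrite expr2; under eq_fun do rewrite expr2; apply: cvgM; exact: cvgL.
move=> /cvgr_to_le; apply.
apply: nearW => n; have [l1 l3] := picard_l2 n M0 lu nu t0.
apply: le_trans l3; apply: total_ge_seq => // i; exact: sqr_ge0.
Unshelve. all: by end_near.
Qed.

End Picard.

(** The difference is at most exp (16 t), since velocities are bounded; inserting
    a bound c exp (16 t) into the equation gives back half of it. *)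
Lemma solution_unique (u w : R -> lattice -> R) :
  (forall i, u 0 i = w 0 i) ->
  (forall i b, {within `[0, b], continuous (u^~ i)}) ->
  (forall i b, {within `[0, b], continuous (w^~ i)}) ->
  (forall (t : R) i, 0 < t -> is_derive t 1 (u^~ i) (velocity (u t) i)) ->
  (forall (t : R) i, 0 < t -> is_derive t 1 (w^~ i) (velocity (w t) i)) ->
  forall (t : R) i, 0 <= t -> u t i = w t i.
Proof.
move=> uw0 cu cw Du Dw t i t0; apply/eqP; rewrite -subr_eq0; apply/eqP.
apply: (@eq0_of_halves _ (expR (16 * t))) => n.
elim: n t i t0 => [|n IH] t i t0.
  rewrite expr0 mulr1.
  have : `|(u t i - w t i) - (u 0 i - w 0 i)| <= 1 * expR (16 * t) - 1 * expR (16 * 0).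
    apply: (mvt_abs t0 (f := fun s => u s i - w s i)
      (df := fun s => velocity (u s) i - velocity (w s) i)
      (p := fun s => 1 * expR (16 * s)) (dp := fun s => 1 * 16 * expR (16 * s))).
    - by move=> s; apply: cvgB; [exact: cu|exact: cw].
    - exact: continuous_exp.
    - by move=> s /andP[s0 _]; apply: is_deriveB; [exact: Du|exact: Dw].
    - by move=> s _; exact: is_derive_exp.
    move=> s /andP[s0 _]; apply: le_trans (ler_normB _ _) _.
    have := velocity_norm (u s) i; have := velocity_norm (w s) i.
    have : 1 <= expR (16 * s) by rewrite -expR0 ler_expR mulr_ge0// ltW.
    lra.
  by rewrite uw0 subrr subr0 mulr0 expR0; lra.
pose c : R := 2^-1 ^+ n.+1.
have c0 : 0 < c by rewrite exprn_gt0.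
have : `|(u t i - w t i) - (u 0 i - w 0 i)| <= c * expR (16 * t) - c * expR (16 * 0).
  apply: (mvt_abs t0 (f := fun s => u s i - w s i)
    (df := fun s => velocity (u s) i - velocity (w s) i)
    (p := fun s => c * expR (16 * s)) (dp := fun s => c * 16 * expR (16 * s))).
  - by move=> s; apply: cvgB; [exact: cu|exact: cw].
  - exact: continuous_exp.
  - by move=> s /andP[s0 _]; apply: is_deriveB; [exact: Du|exact: Dw].
  - by move=> s _; exact: is_derive_exp.
  move=> s /andP[s0 _].
  apply: le_trans (velocity_lip_sup _ (fun j => IH s j (ltW s0))) _.
  by rewrite /c exprSr; lra.
rewrite uw0 subrr subr0 mulr0 expR0 => /le_trans; apply.
by rewrite -/c; lra.
Qed.

End Flow.

(** * Decay of the Lyapunov function and of the energy *)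

Section Decay.
Context {R : realType}.

Lemma le0_of_archi (a c : R) : (forall n, a * n%:R <= c) -> a <= 0.
Proof.
move=> H; have [//|a0] := leP a 0.
have c0 : 0 <= c by have := H 0%N; rewrite mulr0.
have := archi_boundP (divr_ge0 c0 (ltW a0)).
by rewrite ltr_pdivrMr// mulrC ltNge H.
Qed.

(** Subdividing [0, T] into n equal steps gives q T - q 0 <= K T^2 / n. *)
Lemma descent (q : R -> R) (T K : R) : 0 <= T -> 0 <= K ->
  (forall s t, 0 <= s -> s <= t -> t <= T -> q t - q s <= K * (t - s) ^+ 2) ->
  q T <= q 0.
Proof.
move=> T0 K0 H; rewrite -subr_le0; apply: (@le0_of_archi _ (K * T ^+ 2)).
case=> [|n]; first by rewrite mulr0 mulr_ge0 ?sqr_ge0.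
pose h := T / n.+1%:R.
have h0 : 0 <= h by rewrite divr_ge0.
have hn : h * n.+1%:R = T by rewrite divfK.
have step k : (k <= n.+1)%N -> q (h * k%:R) - q 0 <= k%:R * (K * h ^+ 2).
  elim: k => [_|k IH kn]; first by rewrite mulr0 subrr mul0r.
  have kn' : h * k.+1%:R <= T by rewrite -hn ler_wpM2l// ler_nat.
  have kk : h * k.+1%:R = h * k%:R + h by rewrite -natr1 mulrDr mulr1.
  have := H (h * k%:R) (h * k.+1%:R) (mulr_ge0 h0 (ler0n _ _)) _ kn'.
  rewrite kk lerDl => /(_ h0); have := IH (ltnW kn); rewrite -natr1.
  by rewrite (_ : h * k%:R + h - h * k%:R = h); [lra|ring].
have := step _ (leqnn _); rewrite hn => /(ler_wpM2r (ler0n R n.+1)).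
move=> /le_trans; apply; rewrite -hn le_eqVlt; apply/orP; left; apply/eqP; ring.
Qed.

Definition potential (u : lattice -> R) : R :=
  total (fun i => gdprim (dx u i)) + total (fun i => gdprim (dy u i)).

Lemma summ_gdprim (u : lattice -> R) : l2 u -> summ (fun i => gdprim (u i)).
Proof.
apply: summ_le => i; rewrite ger0_norm ?gdprim_ge0//.
exact: le_trans (gdprim_le _) (mul_gd_le _).
Qed.

Lemma potential_ge0 u : 0 <= potential u.
Proof. by apply: addr_ge0; apply: total_ge0 => i; exact: gdprim_ge0. Qed.

Lemma nsq_convex (u w : lattice -> R) : l2 u -> l2 w ->
  nsq u - nsq w <= 2 * total (fun i => u i * (u i - w i)).
Proof.
move=> lu lw.
have sd : summ (fun i => u i * (u i - w i)) by apply: summM => //; exact: l2B.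
rewrite -totalZ// lerBlDr -totalD//; last exact: summZ.
apply: total_le => //; first by apply: summD => //; exact: summZ.
by move=> i; have := sqr_ge0 (u i - w i); nra.
Qed.

(** Convexity of the potential between u and 0, where it vanishes. *)
Lemma potential_le_dissipation (u : lattice -> R) : l2 u ->
  potential u <= - total (fun i => u i * velocity u i).
Proof.
move=> lu; rewrite velocity_by_parts// opprK; apply: lerD; apply: total_le.
- exact/summ_gdprim/l2_dx.
- by apply: summM; [exact: l2_dx|exact/l2_gd/l2_dx].
- by move=> i; exact: gdprim_le.
- exact/summ_gdprim/l2_dy.
- by apply: summM; [exact: l2_dy|exact/l2_gd/l2_dy].
- by move=> i; exact: gdprim_le.
Qed.

(** The subgradient inequality for the convex potential, whose gradient at u is
    minus the velocity. *)
Lemma potential_convex (u w : lattice -> R) : l2 u -> l2 w ->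
  potential u - potential w <= - total (fun i => (u i - w i) * velocity u i).
Proof.
move=> lu lw; have ld := l2B lu lw; rewrite velocity_by_parts// opprK.
rewrite /potential.
have one (p q d : lattice -> R) : l2 p -> l2 q -> l2 d ->
    (forall i, d i = p i - q i) ->
    total (fun i => gdprim (p i)) - total (fun i => gdprim (q i)) <=
    total (fun i => d i * gd (p i)).
  move=> lp lq ld' E; have sd : summ (fun i => d i * gd (p i)).
    by apply: summM => //; exact: l2_gd.
  rewrite lerBlDr -totalD//; last exact: summ_gdprim.
  apply: total_le; [exact: summ_gdprim|by apply: summD => //; exact: summ_gdprim|].
  by move=> i; rewrite -lerBlDr E mulrC; exact: gdprim_convex.
have hx := one _ _ _ (l2_dx lu) (l2_dx lw) (l2_dx ld).
have hy := one _ _ _ (l2_dy lu) (l2_dy lw) (l2_dy ld).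
rewrite opprD addrACA; apply: lerD.
  by apply: hx => i; rewrite /dx; ring.
by apply: hy => i; rewrite /dy; ring.
Qed.

(** The weight h^2 is adapted to w of size O(h^2): both terms are then O(h^2). *)
Lemma total_mul_le (u w : lattice -> R) (h : R) : l2 u -> l2 w -> 0 < h ->
  `|2 * total (fun i => u i * w i)| <= h ^+ 2 * nsq u + nsq w / h ^+ 2.
Proof.
move=> lu lw h0.
have one (z : lattice -> R) : l2 z -> 
    2 * total (fun i => z i * w i) <= h ^+ 2 * nsq z + nsq w / h ^+ 2.
  move=> lz; rewrite [nsq w / _]mulrC -!totalZ//; last exact: summM.
  rewrite -totalD; [|exact: summZ|exact: summZ].
  apply: total_le; [by apply/summZ/summM|by apply: summD; exact: summZ|].
  move=> i; rewrite -subr_ge0.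
  have -> : h ^+ 2 * z i ^+ 2 + (h ^+ 2)^-1 * w i ^+ 2 - 2 * (z i * w i) =
    (h * z i - w i / h) ^+ 2 by field; rewrite gt_eqF.
  exact: sqr_ge0.
have := one _ lu; have := one _ (l2N lu).
have -> : nsq (fun i => - u i) = nsq u.
  by rewrite /nsq; under eq_fun do rewrite sqrrN.
have -> : (fun i => - u i * w i) = (fun i => - (u i * w i)).
  by apply/funext => i; rewrite mulNr.
rewrite totalN ?ler_norml; last exact: summM.
by move=> h1 h2; apply/andP; split; lra.
Qed.

Section Estimates.
Variables (v : R -> lattice -> R) (a b B : R).
Hypotheses (a0 : 0 <= a) (ab : a <= b) (B0 : 0 < B) (sv : solution v)
  (lv : forall t, a <= t <= b -> l2 (v t) /\ nsq (v t) <= B ^+ 2).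

Lemma solution_cont (i : lattice) (c d : R) : 0 <= c ->
  {within `[c, d], continuous (v^~ i)}.
Proof.
move=> c0; apply: within_continuous_ge0 => // s s0.
exact: is_derive_cont (sv s0 i).
Qed.

Lemma within_continuousM (k c d : R) : {within `[c, d], continuous (fun s => k * s)}.
Proof.
by apply: continuous_subspaceT => x; apply: cvgM; [exact: cvg_cst|exact: cvg_id].
Qed.

Lemma is_deriveM (k t : R) : is_derive t 1 (fun s => k * s) k.
Proof. rewrite -[X in is_derive _ _ _ X]mulr1; exact: (is_deriveZ k). Qed.

Lemma solution_l2_lip (s t : R) : a <= s -> s <= t -> t <= b ->
  l2 (fun i => v t i - v s i) /\
  nsq (fun i => v t i - v s i) <= (8 * B * (t - s)) ^+ 2.
Proof.
move=> as_ st tb; rewrite mulrBr.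
have s0 : 0 <= s by exact: le_trans as_.
apply: (mvt_l2_total (dv := fun s => velocity (v s)) (p := fun s => 8 * B * s)
  (dp := fun=> 8 * B) st).
- by move=> i; exact: solution_cont.
- exact: within_continuousM.
- by move=> x i /andP[sx _]; apply: sv; rewrite (le_trans s0)// ltW.
- by move=> x _; exact: is_deriveM.
- by move=> x _; rewrite mulr_gt0.
- move=> x /andP[sx xt]; have [] := lv (t := x).
    by rewrite (le_trans as_ (ltW sx))/= (le_trans (ltW xt)).
  move=> l1 l3; have [l4 l5] := velocity_l2 l1; split=> //.
  by apply: (le_trans l5); rewrite exprMn; lra.
Qed.

(** Second order Taylor estimate in l^2, with the velocity taken at either end of
    the interval (or in between). It follows from the mean value inequality for
    s |-> v s - s * velocity (v c). *)
Lemma solution_taylor (c : R) : a <= c <= b ->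
  l2 (fun i => v b i - v a i - (b - a) * velocity (v c) i) /\
  nsq (fun i => v b i - v a i - (b - a) * velocity (v c) i) <=
    (64 * B * (b - a) ^+ 2) ^+ 2.
Proof.
move=> /andP[ac cb]; pose k := 64 * B * (b - a).
have -> : 64 * B * (b - a) ^+ 2 = k * b - k * a by rewrite /k; ring.
have -> : (fun i => v b i - v a i - (b - a) * velocity (v c) i) =
   (fun i => (v b i - b * velocity (v c) i) - (v a i - a * velocity (v c) i)).
  by apply/funext => i; ring.
apply: (@mvt_l2_total _ (fun s i => v s i - s * velocity (v c) i)
   (fun s i => velocity (v s) i - velocity (v c) i) (fun s => k * s)
  (fun=> k) _ _ ab).
- move=> i x; apply: cvgB; first exact: solution_cont.
  by apply: cvgM; [exact: within_continuous_id|exact: cvg_cst].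
- exact: within_continuousM.
- move=> x i /andP[ax _]; apply: is_deriveB.
    by apply: sv; rewrite (le_trans a0)// ltW.
  have -> : (fun s : R => s * velocity (v c) i) = (fun s => velocity (v c) i * s).
    by apply/funext => s; rewrite mulrC.
  exact: is_deriveM.
- by move=> x _; exact: is_deriveM.
- by move=> x /andP[ax xb]; rewrite !mulr_gt0// subr_gt0 (lt_trans ax).
- move=> x /andP[ax xb].
  have lip : l2 (fun i => v x i - v c i) /\
      nsq (fun i => v x i - v c i) <= (8 * B * (b - a)) ^+ 2.
    have [xc|/ltW cx] := leP x c; last first.
      have [h1 h2] := solution_l2_lip ac cx (ltW xb); split=> //.
      apply: (le_trans h2); rewrite ler_sqr ?nnegrE ?mulr_ge0 ?subr_ge0 ?(ltW B0)//.
      by rewrite ler_wpM2l ?mulr_ge0 ?(ltW B0)//; lra.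
    have [h1 h2] := solution_l2_lip (ltW ax) xc cb.
    have -> : (fun i => v x i - v c i) = (fun i => - (v c i - v x i)).
      by apply/funext => i; ring.
    split; first exact: l2N.
    rewrite /nsq; under eq_fun do rewrite sqrrN.
    apply: (le_trans h2); rewrite ler_sqr ?nnegrE ?mulr_ge0 ?subr_ge0 ?(ltW B0)//.
    by rewrite ler_wpM2l ?mulr_ge0 ?(ltW B0)//; lra.
  have [l1 l3] := velocity_lip_l2 lip.1; split => //; apply: (le_trans l3).
  have := lip.2; rewrite /k => h; apply: (@le_trans _ _ (64 * (8 * B * (b - a)) ^+ 2)).
    by rewrite ler_pM2l.
  by rewrite !exprMn; lra.
Qed.

(** The first order part of the increment is nonpositive: with h = b - a,
    the norm contributes at most 2 h <v b, velocity (v b)> <= - 2 h Phi (v b),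
    which compensates the growth of the factor 2 t, while Phi itself decreases up
    to second order. All remainders come from solution_taylor. *)
Lemma lyapunov_step :
  nsq (v b) + 2 * b * potential (v b) - (nsq (v a) + 2 * a * potential (v a)) <=
  (4097 + 8192 * a) * B ^+ 2 * (b - a) ^+ 2.
Proof.
move: (ab); rewrite le_eqVlt => /predU1P[<-|altb].
  by rewrite !subrr expr0n/= mulr0.
have [lb nb] := lv (t := b) ltac:(by rewrite ab lexx).
have [la na] := lv (t := a) ltac:(by rewrite ab lexx).
have [le ne] := solution_taylor (c := b) ltac:(by rewrite ab lexx).
have [lF nF] := velocity_l2 lb.
set h := b - a in le ne *; have h0 : 0 < h by rewrite subr_gt0.
set e := (fun i => _) in le ne; set F := velocity (v b) in lF nF e le ne *.
have dE : (fun i => v b i - v a i) = (fun i => h * F i + e i).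
  by apply/funext => i; rewrite /e; ring.
have h2 : 0 < h ^+ 2 by rewrite exprn_gt0.
have ne2 : nsq e / h ^+ 2 <= 4096 * B ^+ 2 * h ^+ 2.
  rewrite ler_pdivrMr//; apply: (le_trans ne).
  by rewrite !exprMn le_eqVlt; apply/orP; left; apply/eqP; ring.
have P1 := nsq_convex lb la.
have P2 := potential_le_dissipation lb.
have P3 := potential_convex lb la.
have E1 : total (fun i => v b i * (v b i - v a i)) =
    h * total (fun i => v b i * F i) + total (fun i => v b i * e i).
  rewrite -totalZ; last exact: summM.
  rewrite -totalD; [|by apply/summZ/summM|exact: summM].
  congr total; apply/funext => i; rewrite /e; ring.
have E3 : total (fun i => (v b i - v a i) * F i) =
    h * nsq F + total (fun i => F i * e i).
  rewrite /nsq -totalZ// -totalD; [|exact: summZ|exact: summM].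
  congr total; apply/funext => i; rewrite /e; ring.
rewrite -/F in P2 P3.
have := total_mul_le lb le h0; rewrite ler_norml => /andP[_ Q1].
have := total_mul_le lF le h0; rewrite ler_norml => /andP[Q3 _].
have nF0 := nsq_ge0 F.
have hF : 0 <= h * nsq F by rewrite mulr_ge0// ltW.
rewrite E1 in P1; rewrite E3 in P3.
have bE : b = a + h by rewrite /h; ring.
have {}nF := le_trans nF (ler_wpM2l (ler0n R 64) nb).
have nn : 0 <= B ^+ 2 * h ^+ 2 by rewrite mulr_ge0 ?sqr_ge0.
clear -nn P1 P2 P3 Q1 Q3 hF nF nb ne2 h0 h2 a0 bE.
move: (potential (v b)) (potential (v a)) (nsq (v b)) (nsq (v a))
  (total (fun i => v b i * F i)) (total (fun i => v b i * e i))
  (total (fun i => F i * e i)) (nsq F) (nsq e / h ^+ 2) (B ^+ 2) (h ^+ 2)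
  nn P1 P2 P3 Q1 Q3 hF nF nb ne2 h2 => pb pa qb qa D te Fe nF ne BB hh nn
  P1 P2 P3 Q1 Q3 hF nFB nb neB hh0.
clearbody e; clearbody h; rewrite bE.
have X0 : hh * qb <= hh * BB by rewrite ler_pM2l.
have X1 : hh * nF <= hh * (64 * BB) by rewrite ler_pM2l.
have X2 : h * pb <= - (h * D) by rewrite -mulrN ler_pM2l.
have X3 : pb - pa <= 4096 * (BB * hh) by lra.
have X4 : a * (pb - pa) <= a * (4096 * (BB * hh)) by rewrite ler_wpM2l.
lra.
Qed.

End Estimates.

(** The locally uniform l^2 bound controls the second order remainders on [0, T];
    their constant may depend on T, since the subdivision of [0, T] is arbitrarily
    fine. *)
Lemma lyapunov (v : R -> lattice -> R) : solution v ->
  (forall T, 0 <= T -> exists2 B, 0 < B & forall t, 0 <= t <= T ->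
     l2 (v t) /\ nsq (v t) <= B ^+ 2) ->
  forall t, 0 <= t -> nsq (v t) + 2 * t * potential (v t) <= nsq (v 0).
Proof.
move=> sv lv T T0; have [B B0 lB] := lv T T0.
pose q t := nsq (v t) + 2 * t * potential (v t).
have q0 : q 0 = nsq (v 0) by rewrite /q mulr0 mul0r addr0.
rewrite -q0 -/(q T); pose K := (4097 + 8192 * T) * B ^+ 2.
have K0 : 0 <= K by apply: mulr_ge0; [lra|exact: sqr_ge0].
apply: (descent T0 K0) => s t s0 st tT.
have lst x : s <= x <= t -> l2 (v x) /\ nsq (v x) <= B ^+ 2.
  by move=> /andP[sx xt]; apply: lB; rewrite (le_trans s0)//= (le_trans xt).
apply: le_trans (lyapunov_step s0 st B0 sv lst) _.
apply: ler_wpM2r; first exact: sqr_ge0.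
apply: ler_wpM2r; first exact: sqr_ge0.
lra.
Qed.

(** The smallness of u enters only here: differences along edges are at most
    1/2, the range on which gdprim x >= x^2 / 4. *)
Lemma dirichlet_le (u : lattice -> R) : l2 u -> nsq u <= (4^-1) ^+ 2 ->
  nsq (dx u) + nsq (dy u) <= 4 * potential u.
Proof.
move=> lu nu.
have ui i : `|u i| <= 4^-1.
  have : u i ^+ 2 <= nsq u.
    by apply: (@total_ge1 _ (fun j => u j ^+ 2)) => // j; exact: sqr_ge0.
  move=> /le_trans/(_ nu); rewrite -[u i ^+ 2]real_normK ?num_real//.
  by rewrite ler_sqr ?nnegrE.
have one (p : lattice -> R) : l2 p -> (forall i, `|p i| <= 2^-1) ->
   nsq p <= 4 * total (fun i => gdprim (p i)).
  move=> lp p2; rewrite -totalZ; last exact: summ_gdprim.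
  apply: total_le => //; first exact/summZ/summ_gdprim.
  by move=> i; have := gdprim_ge (p2 i); lra.
rewrite /potential mulrDr; apply: lerD; apply: one; [exact: l2_dx| |exact: l2_dy|].
  move=> i; apply: le_trans (ler_normB _ _) _.
  by have := ui i; have := ui (east i); lra.
move=> i; apply: le_trans (ler_normB _ _) _.
by have := ui i; have := ui (north i); lra.
Qed.

(** Along the half line pt k = i + k e_1, telescoping and
    x^2 - y^2 <= (x - y)^2 / (2 l) + l (x^2 + y^2) give
    u_i^2 <= u_(pt k)^2 + B for every k, where B is the right hand side. Summing
    over k < n yields n (u_i^2 - B) <= nsq u for all n. *)
Lemma sup_bound (u : lattice -> R) (l : R) (i : lattice) : l2 u -> 0 < l ->
  u i ^+ 2 <= nsq (dx u) / (2 * l) + 2 * l * nsq u.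
Proof.
move=> lu l0; set B := _ + _.
pose pt k := iter k east i.
have ptE k : pt k = (i.1 + k%:Z, i.2) :> lattice.
  elim: k => [|k IH]; first by rewrite /pt /= addr0 -surjective_pairing.
  by rewrite /pt iterS -/(pt k) IH /east/= -addn1 PoszD addrA.
have pt_inj : injective pt.
  by move=> k m; rewrite !ptE => -[] /addrI[].
have pt_total (f : lattice -> R) m n : (forall j, 0 <= f j) -> summ f ->
    \sum_(m <= k < n) f (pt k) <= total f.
  move=> f0 sf.
  have -> : \sum_(m <= k < n) f (pt k) =
      \sum_(j <- [seq pt k | k <- index_iota m n]) f j by rewrite big_map.
  by apply: total_ge_seq => //; rewrite map_inj_uniq// iota_uniq.
have sq (w : lattice -> R) j : 0 <= w j ^+ 2 by exact: sqr_ge0.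
have tele n : u i ^+ 2 - u (pt n) ^+ 2 <= B.
  have -> : u i ^+ 2 - u (pt n) ^+ 2 =
      \sum_(0 <= k < n) (u (pt k) ^+ 2 - u (pt k.+1) ^+ 2).
    rewrite -opprB -(telescope_sumr (fun k => u (pt k) ^+ 2) (leq0n n)) -sumrN.
    by apply: eq_bigr => k _; rewrite opprB.
  apply: (@le_trans _ _ (\sum_(0 <= k < n) ((2 * l)^-1 * dx u (pt k) ^+ 2 +
      l * (u (pt k) ^+ 2 + u (east (pt k)) ^+ 2)))).
    apply: ler_sum => k _; rewrite /dx /pt iterS -/(pt k).
    move: (u (pt k)) (u (east (pt k))) => x y; rewrite -subr_ge0.
    have -> : (2 * l)^-1 * (y - x) ^+ 2 + l * (x ^+ 2 + y ^+ 2) -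
       (x ^+ 2 - y ^+ 2) = l / 2 * ((y - x) / l + (x + y)) ^+ 2 +
       l / 2 * (x - y) ^+ 2 by field; rewrite gt_eqF.
    by rewrite addr_ge0// mulr_ge0 ?sqr_ge0 ?divr_ge0// ltW.
  rewrite big_split/= -!mulr_sumr big_split/= /B.
  have h1 := pt_total _ 0%N n (sq (dx u)) (l2_dx lu).
  have h2 := pt_total _ 0%N n (sq u) lu.
  have h3 := pt_total _ 0%N n (sq (u \o east)) (l2_shift eastK lu).
  have E3 : total (fun j => (u \o east) j ^+ 2) = nsq u.
    exact: (total_reindex eastK westK lu).
  rewrite E3 in h3.
  apply: lerD; first by rewrite [leRHS]mulrC ler_pM2l// invr_gt0 mulr_gt0.
  rewrite [2 * l]mulrC -mulrA ler_pM2l// mulr_natl mulr2n.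
  exact: lerD.
rewrite -subr_le0; apply: (@le0_of_archi _ (nsq u)) => n.
have h2 := pt_total _ 0%N n (sq u) lu.
apply: le_trans h2.
have -> : (u i ^+ 2 - B) * n%:R = \sum_(0 <= k < n) (u i ^+ 2 - B).
  by rewrite sumr_const_nat subn0 mulr_natr.
by apply: ler_sum => k _; have := tele k; lra.
Qed.

End Decay.

(** * Norms, energy and difference quotients *)

Section Conversions.
Context {R : realType}.
Implicit Types (u f : lattice -> R).

(** Bridge between the extended-real norm and real-valued sums. *)
Lemma lnorm2_leP f (c : R) : 0 <= c ->
  (lnorm 2%:E f <= c%:E)%E <-> (l2 f /\ nsq f <= c ^+ 2).
Proof.
move=> c0.
have E : (lnorm 2%:E f `^ 2 = \int[@counting lattice R]_i (f i ^+ 2)%:E)%E.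
  rewrite /lnorm poweR_Lnorm//; apply: eq_integral => i _ /=.
  by rewrite powR_mulrn// real_normK ?num_real.
have N0 : (0 <= lnorm 2%:E f)%E by exact: Lnorm_ge0.
split.
  move=> Nc; have : (lnorm 2%:E f \is a fin_num).
    by rewrite ge0_fin_numE// (le_lt_trans Nc) ?ltry.
  move: E N0 Nc; case: (lnorm 2%:E f) => [r||]//; rewrite lee_fin => E r0.
  rewrite lee_fin => rc _.
  apply: summ_total_le => [i|s us]; first exact: sqr_ge0.
  rewrite -lee_fin -sumEFin.
  apply: (@le_trans _ _ (\int[@counting lattice R]_i (f i ^+ 2)%:E)%E).
    by apply: integral_lattice_ge => // i; rewrite lee_fin sqr_ge0.
  by rewrite -E poweR_EFin powR_mulrn// lee_fin ler_sqr.
move=> [lf nf].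
have : (\int[@counting lattice R]_i (f i ^+ 2)%:E <= (c ^+ 2)%:E)%E.
  rewrite -[leLHS]fineK; last exact: integrable_fin_num.
  by rewrite lee_fin.
rewrite -E; move: N0; case: (lnorm 2%:E f) => [r||]//; last first.
  by rewrite /= pnatr_eq0.
by rewrite lee_fin => r0; rewrite poweR_EFin powR_mulrn// !lee_fin ler_sqr.
Qed.

Lemma lnorm_ge0 (p : \bar R) f : (0 <= lnorm p f)%E.
Proof. exact: Lnorm_ge0. Qed.

Lemma lnormoo_le f (c : R) : (forall i, `|f i| <= c) -> (lnorm +oo%E f <= c%:E)%E.
Proof.
move=> fc; rewrite /lnorm unlock; case: ifPn => _.
  by apply/ess_sup_inf.ess_supP; apply: aeW => i /=; rewrite lee_fin.
by rewrite lee_fin; apply: le_trans (fc (0, 0)).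
Qed.

Lemma cvge0P (T : Type) (F : set_system T) (FF : Filter F) (f : T -> \bar R) :
  (forall x, (0 <= f x)%E) ->
  (forall e : R, 0 < e -> \forall x \near F, (f x <= e%:E)%E) ->
  f x @[x --> F] --> 0%E.
Proof.
move=> f0 H; apply/fine_cvgP; split.
  have := H 1 ltr01; apply: filterS => x fx.
  by rewrite ge0_fin_numE// (le_lt_trans fx) ?ltry.
apply/cvgrPdist_le => e e0; have := H e e0; apply: filterS => x.
rewrite sub0r normrN /=; case: (f x) (f0 x) => [r||]//=; rewrite !lee_fin.
by move=> r0; rewrite ger0_norm.
Qed.

Lemma edgeP (e : lattice * lattice) : edges e ->
  e.2 = east e.1 \/ e.2 = north e.1.
Proof.
case: e => i j [/= adj h1 h2].
have : [set k | Defs.adjacent k i] j by rewrite /= /Defs.adjacent -adj; ring.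
rewrite neighbours /= !inE => /or4P[] /eqP E; [by left| |by right|].
  by move: h1; rewrite E /west/= => h1; lia.
by move: h2; rewrite E /south/= => h2; lia.
Qed.

(** Every edge has the form (i, east i) or (i, north i), so a finite set of edges
    splits into two families indexed by distinct lattice points. *)
Lemma energy_le u : l2 u -> (energy u <= (nsq (dx u) + nsq (dy u))%:E)%E.
Proof.
move=> lu; apply/ereal_supP => _ [A [fA AE] <-].
rewrite fsbig_finite//= sumEFin lee_fin.
set s := finmap.enum_fset _.
have sA e : e \in s -> edges e.
  move=> es; apply: AE; rewrite -(in_setE A) -in_fset_set//.
have us : uniq s by exact: finmap.fset_uniq.
pose hor (e : lattice * lattice) := e.2 == east e.1.
rewrite (bigID hor)/=; apply: lerD.
  rewrite -big_filter.
  have -> : \sum_(e <- [seq e <- s | hor e]) `|u e.1 - u e.2| ^+ 2 =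
    \sum_(i <- [seq e.1 | e <- [seq e <- s | hor e]]) dx u i ^+ 2.
    rewrite big_map; apply: eq_big_seq => e; rewrite mem_filter => /andP[/eqP he _].
    by rewrite real_normK ?num_real// he /dx -sqrrN opprB.
  apply: total_ge_seq; [by move=> i; exact: sqr_ge0|exact: l2_dx|].
  rewrite map_inj_in_uniq ?filter_uniq// => -[i j] [i' j'].
  rewrite !mem_filter /hor => /andP[/= /eqP -> _] /andP[/= /eqP -> _] ->//.
rewrite -big_filter.
have nh e : e \in [seq e <- s | ~~ hor e] -> e.2 = north e.1.
  rewrite mem_filter => /andP[/eqP he /sA/edgeP[]//].
have -> : \sum_(e <- [seq e <- s | ~~ hor e]) `|u e.1 - u e.2| ^+ 2 =
  \sum_(i <- [seq e.1 | e <- [seq e <- s | ~~ hor e]]) dy u i ^+ 2.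
  rewrite big_map; apply: eq_big_seq => e /nh he.
  by rewrite real_normK ?num_real// he /dy -sqrrN opprB.
apply: total_ge_seq; [by move=> i; exact: sqr_ge0|exact: l2_dy|].
rewrite map_inj_in_uniq ?filter_uniq// => -[i j] [i' j'].
by move=> /nh/= -> /nh/= -> ->.
Qed.

(** A form free of quotients and punctured filters, in which one-sided and
    two-sided derivatives can be compared directly. *)
Lemma has_deriv_ge0P (f : R -> R) (t d : R) : has_deriv_ge0 f t d <->
  (forall e : R, 0 < e -> exists2 k : R, 0 < k & forall s, 0 <= s -> `|s - t| < k ->
     `|f s - f t - (s - t) * d| <= e * `|s - t|).
Proof.
have tr s : s != t -> `|f s - f t - (s - t) * d| =
    `|d - (s - t)^-1 * (f s - f t)| * `|s - t|.
  rewrite -subr_eq0 => st; rewrite -normrM distrC; congr `|_|; by field.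
split=> [/cvgrPdist_le H e e0|H].
  have := H e e0; rewrite !near_withinE => /nbhs_ballP[k /= k0 Hk].
  exists k => // s s0 sk; have [->|st] := eqVneq s t.
    by rewrite !subrr mul0r subrr normr0 mulr0.
  rewrite tr//; apply: ler_wpM2r => //.
  by apply: (Hk s) => //=; rewrite /ball/= distrC.
apply/cvgrPdist_le => e e0; have [k k0 Hk] := H e e0.
rewrite !near_withinE; apply/nbhs_ballP; exists k => //= s.
rewrite /ball/= distrC => sk st s0.
have := Hk s s0 sk; rewrite tr// ler_pM2r// normr_gt0 subr_eq0//.
Qed.

Lemma is_deriveP (f : R -> R) (t d : R) : is_derive t 1 f d <->
  (forall e : R, 0 < e -> exists2 k : R, 0 < k & forall s, `|s - t| < k ->
     `|f s - f t - (s - t) * d| <= e * `|s - t|).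
Proof.
have tr h : h != 0 -> `|f (h + t) - f t - h * d| =
    `|d - h^-1 * (f (h + t) - f t)| * `|h|.
  by move=> h0; rewrite -normrM distrC; congr `|_|; field.
split=> [[df fd] e e0|H].
  have : h^-1 *: (f (h *: 1 + t) - f t) @[h --> 0^'] --> d by rewrite -fd.
  move=> /cvgrPdist_le/(_ e e0).
  rewrite !near_withinE => /nbhs_ballP[k /= k0 Hk].
  exists k => // s sk; have [->|st] := eqVneq s t.
    by rewrite !subrr mul0r subrr normr0 mulr0.
  have := tr (s - t); rewrite subr_eq0 subrK => -> //; apply: ler_wpM2r => //.
  have := Hk (s - t); rewrite /ball/= sub0r normrN subr_eq0 => /(_ sk st).
  by rewrite [_ *: 1]mulr1 subrK.
have cv : h^-1 *: (f (h *: 1 + t) - f t) @[h --> 0^'] --> d.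
  apply/cvgrPdist_le => e e0; have [k k0 Hk] := H e e0.
  rewrite !near_withinE; apply/nbhs_ballP; exists k => //= h.
  rewrite /ball/= sub0r normrN => hk h0.
  have := Hk (h + t); rewrite addrK => /(_ hk); rewrite tr// ler_pM2r ?normr_gt0//.
  by rewrite [_ *: 1]mulr1.
by apply: DeriveDef; [apply/cvg_ex; exists d|exact/cvg_lim].
Qed.

Lemma is_derive_has_deriv (f : R -> R) (t d : R) :
  is_derive t 1 f d -> has_deriv_ge0 f t d.
Proof.
move=> /is_deriveP H; apply/has_deriv_ge0P => e /H[k k0 Hk].
by exists k => // s _; exact: Hk.
Qed.

Lemma has_deriv_is_derive (f : R -> R) (t d : R) : 0 < t ->
  has_deriv_ge0 f t d -> is_derive t 1 f d.
Proof.
move=> t0 /has_deriv_ge0P H; apply/is_deriveP => e /H[k k0 Hk].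
exists (Num.min k t); first by rewrite lt_min k0.
move=> s; rewrite lt_min => /andP[sk st]; apply: Hk => //.
by move: st; rewrite ltr_norml; lra.
Qed.

Lemma has_deriv_cvg (f : R -> R) (t d : R) : has_deriv_ge0 f t d ->
  f s @[s --> within [set s | 0 <= s] (nbhs t)] --> f t.
Proof.
move=> /has_deriv_ge0P/(_ 1 ltr01)[k k0 Hk]; apply/cvgrPdist_le => e e0.
rewrite near_withinE; apply/nbhs_ballP.
have d0 : 0 < `|d| + 1 by rewrite ltr_wpDl.
exists (Num.min k (e / (`|d| + 1))); first by rewrite /= lt_min k0 divr_gt0.
move=> s; rewrite /ball/= distrC lt_min => /andP[sk se] s0.
rewrite distrC; move: se; rewrite ltr_pdivlMr// => se.
have -> : f s - f t = (f s - f t - (s - t) * d) + (s - t) * d by rewrite subrK.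
apply: le_trans (ler_normD _ _) _; rewrite normrM.
by have := Hk s s0 sk; lra.
Qed.

Lemma has_deriv_within (f : R -> R) (d : R -> R) (b : R) :
  (forall t, 0 <= t -> has_deriv_ge0 f t (d t)) -> {within `[0, b], continuous f}.
Proof.
move=> H; apply/subspace_continuousP => x; rewrite /= in_itv/= => /andP[x0 _].
apply: cvg_trans (has_deriv_cvg (H x x0)).
apply: cvg_app; apply: within_subset => s; rewrite /= in_itv/= => /andP[]//.
Qed.

End Conversions.

(** * Convergence of the combinatorial Ricci flow *)

Section Assembly.
Context {R : realType}.

Lemma lnorm_cvg0 (F : set_system R) (FF : Filter F) (p : \bar R)
  (f : R -> lattice -> R) :
  (forall e : R, 0 < e -> \forall s \near F, (lnorm p (f s) <= e%:E)%E) ->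
  lnorm p (f s) @[s --> F] --> 0%E.
Proof. by move=> H; apply: cvge0P => // s; exact: lnorm_ge0. Qed.

Variable v : R -> lattice -> R.
Hypotheses (sv : solution v)
  (lv : forall t, 0 <= t -> l2 (v t) /\ nsq (v t) <= (4^-1) ^+ 2).

Let lv' (a b : R) : 0 <= a -> forall t, a <= t <= b ->
  l2 (v t) /\ nsq (v t) <= (4^-1) ^+ 2.
Proof. by move=> a0 t /andP[at_ _]; apply: lv; exact: le_trans at_. Qed.

(** The constant 16 is 64 * B with the bound B = 1/4 on the l^2 norm. *)
Lemma solution_quotient (s t : R) : 0 <= s -> 0 <= t -> s != t ->
  (lnorm 2%:E (fun i => (s - t)^-1 * (v s i - v t i) - velocity (v t) i)%R
   <= (16 * `|s - t|)%:E)%E.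
Proof.
move=> s0 t0 st; have st0 : s - t != 0 by rewrite subr_eq0.
have q0 : 0 < (4^-1 : R) by lra.
have [lw nw] : l2 (fun i => v s i - v t i - (s - t) * velocity (v t) i) /\
    nsq (fun i => v s i - v t i - (s - t) * velocity (v t) i) <=
    (64 * 4^-1 * (s - t) ^+ 2) ^+ 2.
  have [le|/ltW le] := leP t s.
    by apply: (solution_taylor t0 le q0 sv (lv' t0)); rewrite lexx.
  have [h1 h2] := solution_taylor s0 le q0 sv (lv' s0) (c := t)
    ltac:(by rewrite le lexx).
  have -> : (fun i => v s i - v t i - (s - t) * velocity (v t) i) =
     (fun i => - (v t i - v s i - (t - s) * velocity (v t) i)).
    by apply/funext => i; ring.
  split; first exact: l2N.
  rewrite /nsq; under eq_fun do rewrite sqrrN.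
  by rewrite -(sqrrN (s - t)) opprB.
have -> : (fun i => (s - t)^-1 * (v s i - v t i) - velocity (v t) i) =
   (fun i => (s - t)^-1 * (v s i - v t i - (s - t) * velocity (v t) i)).
  by apply/funext => i; field.
apply/lnorm2_leP; first by rewrite mulr_ge0.
split; first exact: l2Z.
rewrite nsqZ//; apply: (@le_trans _ _ ((s - t)^-1 ^+ 2 *
   (64 * 4^-1 * (s - t) ^+ 2) ^+ 2)); first by rewrite ler_wpM2l ?sqr_ge0.
rewrite [leRHS]exprMn real_normK ?num_real// le_eqVlt; apply/orP; left; apply/eqP.
by field.
Qed.

Lemma velocity_lipschitz (s t : R) : 0 <= s -> 0 <= t ->
  (lnorm 2%:E (fun i => velocity (v s) i - velocity (v t) i)%R <= (16 * `|s - t|)%:E)%E.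
Proof.
move=> s0 t0; have q0 : 0 < (4^-1 : R) by lra.
have [lw nw] : l2 (fun i => v s i - v t i) /\
    nsq (fun i => v s i - v t i) <= (8 * 4^-1 * `|s - t|) ^+ 2.
  have [le|/ltW le] := leP t s.
    rewrite ger0_norm ?subr_ge0//.
    exact: (solution_l2_lip t0 q0 sv (lv' t0) (lexx _) le (lexx _)).
  have [h1 h2] := solution_l2_lip s0 q0 sv (lv' s0) (lexx _) le (lexx _).
  have -> : (fun i => v s i - v t i) = (fun i => - (v t i - v s i)).
    by apply/funext => i; ring.
  split; first exact: l2N.
  rewrite /nsq; under eq_fun do rewrite sqrrN.
  by rewrite distrC ger0_norm ?subr_ge0.
have [lf nf] := velocity_lip_l2 lw.
apply/lnorm2_leP; first by rewrite mulr_ge0.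
split=> //; apply: (le_trans nf); rewrite !exprMn in nw *; lra.
Qed.

Lemma solution_C1_l2 : C1_l2 v.
Proof.
exists (fun t => velocity (v t)) => t t0.
have fin (f : lattice -> R) : l2 f -> (lnorm 2%:E f < +oo)%E.
  move=> lf; apply: (@le_lt_trans _ _ (Num.sqrt (nsq f))%:E); last exact: ltry.
  by apply/lnorm2_leP; rewrite ?sqrtr_ge0// sqr_sqrtr// nsq_ge0.
have [lt _] := lv t0.
split; [exact: fin|by apply: fin; exact: (velocity_l2 lt).1| |].
  apply: lnorm_cvg0 => e e0; rewrite !near_withinE; apply/nbhs_ballP.
  exists (e / 16) => /=; first by rewrite divr_gt0.
  move=> s; rewrite /ball/= distrC => st s_t s0.
  apply: le_trans (solution_quotient s0 t0 s_t) _.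
  by rewrite lee_fin mulrC -ler_pdivlMr// ltW.
apply: lnorm_cvg0 => e e0; rewrite !near_withinE; apply/nbhs_ballP.
exists (e / 16) => /=; first by rewrite divr_gt0.
move=> s; rewrite /ball/= distrC => st s0.
apply: le_trans (velocity_lipschitz s0 t0) _.
by rewrite lee_fin mulrC -ler_pdivlMr// ltW.
Qed.

Lemma solution_dirichlet (t : R) : 0 <= t -> nsq (v 0) <= (4^-1) ^+ 2 ->
  nsq (dx (v t)) + nsq (dy (v t)) <= (1 + t)^-1.
Proof.
move=> t0 n0.
have L : nsq (v t) + 2 * t * potential (v t) <= nsq (v 0).
  apply: (lyapunov sv) => // T T0; exists 4^-1; first by lra.
  exact: lv'.
have [lt nt] := lv t0.
have E1 := dirichlet_le lt nt.
have E2 := nsq_dx_le lt.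
have P0 := nsq_ge0 (v t).
have t1 : 0 < 1 + t by lra.
rewrite -[leRHS]mul1r ler_pdivlMr// mulrDr mulr1.
have : (nsq (dx (v t)) + nsq (dy (v t))) * t <= 4 * potential (v t) * t.
  by rewrite ler_wpM2r.
move: (potential (v t)) (nsq (v t)) (nsq (v 0)) (nsq (dx (v t)) + nsq (dy (v t)))
  L nt n0 E1 E2 P0 => p a b d L nt n0 E1 E2 P0 E3.
lra.
Qed.

(** sup_bound is used with l = e^2: the energy at times t >= 1 / e^4 is at most
    e^4, and nsq (v t) <= 1/16, so the bound is e^2 / 2 + e^2 / 8. *)
Lemma solution_sup (e : R) : 0 < e -> nsq (v 0) <= (4^-1) ^+ 2 ->
  exists2 T, 0 <= T & forall t, T <= t -> forall i, `|v t i| <= e.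
Proof.
move=> e0 n0; exists (e ^+ 4)^-1; first by rewrite invr_ge0 exprn_ge0// ltW.
move=> t tT i; have T0 : 0 < (e ^+ 4)^-1 by rewrite invr_gt0 exprn_gt0.
have t0 : 0 <= t by rewrite (le_trans (ltW T0)).
have [lt nt] := lv t0.
have e2 : 0 < e ^+ 2 by rewrite exprn_gt0.
have D := solution_dirichlet t0 n0.
have D' := nsq_ge0 (dy (v t)).
rewrite -ler_sqr ?nnegrE ?(ltW e0)// real_normK ?num_real//.
apply: le_trans (sup_bound i lt e2) _.
have h1 : nsq (dx (v t)) <= e ^+ 4.
  apply: (@le_trans _ _ (1 + t)^-1).
    by move: (nsq (dx _)) (nsq (dy _)) D D' => a b D D'; lra.
  rewrite -[leRHS]invrK lef_pV2 ?posrE//; first by lra.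
  by lra.
have h2 : nsq (dx (v t)) / (2 * e ^+ 2) <= e ^+ 2 / 2.
  rewrite ler_pdivrMr ?mulr_gt0//; apply: (le_trans h1).
  by rewrite le_eqVlt; apply/orP; left; apply/eqP; field.
have h3 : e ^+ 2 * nsq (v t) <= e ^+ 2 * (4^-1) ^+ 2 by rewrite ler_pM2l.
apply: le_trans (lerD h2 (_ : _ <= e ^+ 2 / 8)) _; last by lra.
by rewrite -mulrA; lra.
Qed.

End Assembly.

Theorem theorem1p8 (R : realType) :
  exists eps : R, 0 < eps /\ exists C : R,
  forall r0 : lattice -> R, (forall i, 0 < r0 i) ->
  (lnorm 2%:E (fun i => ln (r0 i)) <= eps%:E)%E ->
  exists r : R -> lattice -> R,
    let u := fun (t : R) (i : lattice) => ln (r t i) in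
    [/\ ricci_flow (fun _ _ => pi / 2) r0 r,
        forall r' : R -> lattice -> R, ricci_flow (fun _ _ => pi / 2) r0 r' ->
          forall t : R, 0 <= t -> r' t = r t,
        forall i, r t i @[t --> +oo] --> (1 : R)
      & [/\ C1_l2 u,
            lnorm +oo%E (u t) @[t --> +oo] --> 0%E
          & forall t : R, 0 <= t -> (energy (u t) <= (C * (1 + t)^-1)%:E)%E]].
Proof.
have q0 : 0 < (4^-1 : R) by lra.
(* (1 + t) E <= 8 |u(0)|^2 + 2 |u(0)|^2 = 10 / 16 <= 1 *)
exists 4^-1; split=> //; exists 1 => r0 r00 /lnorm2_leP[|lu nu]; first exact: ltW.
have [v [v0 sv lv0]] := exists_solution q0 lu nu.
have lv t : 0 <= t -> l2 (v t) /\ nsq (v t) <= (4^-1) ^+ 2.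
  move=> t0; split; first exact: (lv0 t t0).1.
  apply: le_trans nu; rewrite -v0.
  have L : nsq (v t) + 2 * t * potential (v t) <= nsq (v 0).
    apply: (lyapunov sv) => // T T0.
    exists (2 * 4^-1 * expR (16 * T)); first by rewrite !mulr_gt0 ?expR_gt0.
    move=> s /andP[s0 sT]; have [h1 h2] := lv0 s s0; split=> //.
    apply: (le_trans h2); rewrite ler_sqr ?nnegrE ?mulr_ge0 ?expR_ge0 ?(ltW q0)//.
    by rewrite ler_pM2l ?mulr_gt0// ler_expR ler_pM2l.
  apply: le_trans L; rewrite lerDl mulr_ge0 ?potential_ge0//.
  by rewrite mulr_ge0.
have n0 : nsq (v 0) <= (4^-1) ^+ 2 by rewrite v0.
pose r t i := expR (v t i).
have curvE t i : curvature (fun _ _ => pi / 2) (r t) i = - velocity (v t) i.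
  rewrite curvature_right_angle; last by move=> j; exact: expR_gt0.
  by congr (- velocity _ i); apply/funext => j; rewrite expRK.
exists r => u.
have -> : u = v by apply/funext => t; apply/funext => i; exact: expRK.
split.
- split; first by apply/funext => i; rewrite /r v0 lnK ?posrE.
  move=> t t0 i; split; first exact: expR_gt0.
  apply: is_derive_has_deriv; rewrite curvE opprK mulrC.
  by apply: is_derive1_comp; exact: sv.
- move=> r' [r'0 flow] t t0; apply/funext => i.
  have r'_gt0 (s : R) j : 0 <= s -> 0 < r' s j by move=> s0; exact: (flow s s0 j).1.
  have Dr' (s : R) j : 0 < s -> is_derive s 1 (fun x => ln (r' x j))
      (velocity (fun k => ln (r' s k)) j).
    move=> s0; have [rs ds] := flow s (ltW s0) j.
    have D := has_deriv_is_derive s0 ds.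
    rewrite curvature_right_angle in D; last by move=> k; apply: r'_gt0; exact: ltW.
    have -> : velocity (fun k => ln (r' s k)) j = (r' s j)^-1 *
        (- - velocity (fun k => ln (r' s k)) j * r' s j).
      by field; rewrite gt_eqF.
    apply: is_derive1_comp; exact: is_derive1_ln.
  suff E : ln (r' t i) = v t i by rewrite /r -E lnK ?posrE ?r'_gt0.
  apply: (solution_unique (u := fun s j => ln (r' s j)) (w := v)) => //.
  + by move=> j; rewrite r'0 v0.
  + move=> j b; have /subspace_continuousP c : {within `[0, b], continuous (r'^~ j)}.
      by apply: has_deriv_within => s s0; exact: (flow s s0 j).2.
    apply/subspace_continuousP => x xb; apply: cvg_comp (c x xb) _.
    apply: continuous_ln; apply: r'_gt0.
    by move: xb; rewrite /= in_itv/= => /andP[].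
  + move=> j b; apply: within_continuous_ge0 => // s s0.
    exact: is_derive_cont (sv s s0 j).
  + by move=> s j s0; apply: sv; exact: ltW.
- move=> i; rewrite -(@expR0 R); apply: (@cvg_comp _ _ _ (v^~ i) expR).
    2: exact: continuous_expR.
  apply/cvgrPdist_le => e e0; have [T T0 HT] := solution_sup sv lv e0 n0.
  by exists T; split=> [|t /ltW /HT/(_ i)]; rewrite ?num_real// sub0r normrN.
split.
- exact: solution_C1_l2.
- apply: lnorm_cvg0 => e e0; have [T T0 HT] := solution_sup sv lv e0 n0.
  by exists T; split=> [|t /ltW /HT Ht]; rewrite ?num_real//; exact: lnormoo_le.
- move=> t t0; apply: (le_trans (energy_le (lv t t0).1)).
  by rewrite lee_fin mul1r; exact: solution_dirichlet.
Qed.
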